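(* Let $k\ge3$, $\theta\in\mathcal{P}(B)$ and $t\in V_1\otimes\cdots\otimes V_k$ a complex tensor. Then $E^\theta(t)\ge E_\theta(t)$ (for any fixed ordering of $\operatorname{supp}\theta$ used in the definition of $E^\theta$).
   Context: All vector spaces are finite-dimensional complex; $[k]=\{1,\dots,k\}$, $\overline S=[k]\setminus S$, $V_S=\bigotimes_{j\in S}V_j$; $B$ is the set of bipartitions $\{S,\overline S\}$ of $[k]$ ($S,\overline S$ nonempty), $\mathcal{P}(B)$ the probability distributions on $B$. $H$ is Shannon entropy base 2 or von Neumann entropy $-\operatorname{Tr}\rho\log_2\rho$; for $\lambda\vdash n$, $\overline\lambda=(\lambda_1/n,\lambda_2/n,\dots)$. Schur–Weyl: $V^{\otimes n}\cong\bigoplus_{\lambda\vdash n}\mathbb{S}_\lambda(V)\otimes[\lambda]$ as $\mathrm{GL}(V)\times S_n$-modules; $P^V_\lambda$ is the equivariant projection onto the $\lambda$-isotypic component. For $S\subseteq[k]$, under $(V_{[k]})^{\otimes n}\cong(V_S)^{\otimes n}\otimes(V_{\overline S})^{\otimes n}$ let $P^{V_S}_\lambda$ act as $P^{V_S}_\lambda\otimes\mathrm{Id}$; with the symmetriser $P^{V_{[k]}}_{(n)}=\frac1{n!}\sum_{\pi\in S_n}\pi$, set $P^{V_b}_\lambda=P^{V_S}_\lambda P^{V_{[k]}}_{(n)}$ for $b=\{S,\overline S\}$. Upper quantum functional: list $\operatorname{supp}\theta=\{b_1,\dots,b_\ell\}$ in a fixed order; $E^\theta(t)=\sup\sum_{i}\theta(b_i)H(\overline{\lambda^{(b_i)}})$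 over all $n\ge1$ and partitions $\lambda^{(b_i)}\vdash n$ with $P^{V_{b_\ell}}_{\lambda^{(b_\ell)}}\cdots P^{V_{b_1}}_{\lambda^{(b_1)}}t^{\otimes n}\ne0$. Lower quantum functional: with inner products on the $V_j$, for nonzero $\psi$ let $\rho=|\psi\rangle\langle\psi|/\langle\psi|\psi\rangle$, $\rho_S$ its marginal on $V_S$, $H_\theta(\psi)=\sum_{\{S,\overline S\}\in B}\theta(\{S,\overline S\})H(\rho_S)$, and $E_\theta(t)=\sup_{A_j\in\mathrm{GL}(V_j)}H_\theta((A_1\otimes\cdots\otimes A_k)t)$ ($E^\theta(0)=E_\theta(0)=-\infty$). *)

(* Defs.v *)
From HB Require Import structures.
From mathcomp Require Import boolp classical_sets reals ereal exp.
From mathcomp Require Import all_boot all_order all_fingroup all_algebra.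
From mathcomp Require Import complex spectral.

Set Implicit Arguments.
Unset Strict Implicit.
Unset Printing Implicit Defensive.

Import Order.TTheory GRing.Theory Num.Theory.
Local Open Scope ring_scope.
Local Open Scope complex_scope.

(** * Entropies *)

(* [ln x = 0] for [x <= 0], so that [0 * log2 0 = 0]. *)
Definition log2 (R : realType) (x : R) : R := ln x / ln 2.

Definition is_part (n : nat) (la : seq nat) : bool :=
  [&& sorted geq la, 0%N \notin la & sumn la == n].

(* Shannon entropy of [la / n]. *)
Definition shannon_part (R : realType) (n : nat) (la : seq nat) : R :=
  - \sum_(i <- la) (i%:R / n%:R) * log2 (i%:R / n%:R).

(* [log2] of a Hermitian matrix by functional calculus; its value on the kernel
   is immaterial in [vN_entropy]. *)
Definition mxlog2 (R : realType) (m : nat) (rho : 'M[R[i]]_m) : 'M[R[i]]_m :=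
  invmx (spectralmx rho)
  *m diag_mx (map_mx (fun z : R[i] => (log2 (complex.Re z))%:C)
                (spectral_diag rho))
  *m spectralmx rho.

Definition vN_entropy (R : realType) (m : nat) (rho : 'M[R[i]]_m) : R :=
  complex.Re (- \tr (rho *m mxlog2 rho)).

(** * Tensor powers and isotypic projections *)

(* The complex vector space with basis [X]. *)
Definition cspace (R : realType) (X : finType) := {ffun X -> R[i]^o}.

(* The [n]-th tensor power of [cspace R X]. *)
Definition tpow (R : realType) (X : finType) (n : nat) :=
  cspace R {ffun 'I_n -> X}.

Section Isotypic.
Variables (R : realType) (n : nat).
Local Notation C := (R[i]).

(* [sact p] sends the basis vector [e_x] to [e_(x \o p^-1)]: a left action for
   composition of permutations.  Composition is the opposite of the product
   [*%g] of ['S_n]: [(p \o q) i = (q * p)%g i]. *)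
Definition sact (X : finType) (p : 'S_n) (T : tpow R X n) : tpow R X n :=
  [ffun x : {ffun 'I_n -> X} => T [ffun i => x (p i)]].

(* [g^{(x) n}] *)
Definition glact (X : finType) (g : 'M[C]_#|X|) (T : tpow R X n) : tpow R X n :=
  [ffun x : {ffun 'I_n -> X} => \sum_(y : {ffun 'I_n -> X})
     (\prod_i g (enum_rank (x i)) (enum_rank (y i))) * T y].

Definition galg := cspace R 'S_n.

(* Left translation, again for the composition product. *)
Definition galg_act (p : 'S_n) (a : galg) : galg :=
  [ffun s => a (s * p^-1)%g].

Definition galg_mul (a b : galg) : galg :=
  [ffun s => \sum_p a p * b (s * p^-1)%g].

(* The boxes of the Young diagram of [la] are numbered row by row:
   [reshape_index la i] and [reshape_offset la i] are the row and the column of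
   the box with number [i]. *)
Definition row_stab (la : seq nat) (p : 'S_n) : bool :=
  [forall i : 'I_n, reshape_index la (p i) == reshape_index la i].

Definition col_stab (la : seq nat) (p : 'S_n) : bool :=
  [forall i : 'I_n, reshape_offset la (p i) == reshape_offset la i].

Definition young_sym (la : seq nat) : galg :=
  [ffun s => \sum_(p | row_stab la p) \sum_(q | col_stab la q)
     (-1) ^+ (odd_perm q) * (s == (q * p)%g)%:R].

(* The module [[la]], as the left ideal generated by the Young symmetriser. *)
Definition specht (la : seq nat) (a : galg) : Prop :=
  exists b : galg, a = galg_mul b (young_sym la).

(* The restriction of [f] to [[la]] is a morphism of representations. *)
Definition specht_hom (X : finType) (la : seq nat)
    (f : 'Hom(galg, tpow R X n)) : Prop :=
  forall p a, specht la a -> f (galg_act p a) = sact p (f a).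

(* The sum of the images of all morphisms from [[la]] to the tensor power. *)
Definition isotypic (X : finType) (la : seq nat) (T : tpow R X n) : Prop :=
  exists (m : nat) (f : 'I_m -> 'Hom(galg, tpow R X n)) (a : 'I_m -> galg),
    (forall i, specht_hom la (f i) /\ specht la (a i))
    /\ T = \sum_(i < m) f i (a i).

Definition is_isoproj (X : finType) (la : seq nat) (P : 'End(tpow R X n)) :
    Prop :=
  [/\ forall p T, P (sact p T) = sact p (P T),
      forall g T, g \in unitmx -> P (glact g T) = glact g (P T),
      (P \o P)%VF = P
    & forall T, T \in limg P <-> isotypic la T].

Definition isoproj (X : finType) (la : seq nat) : 'End(tpow R X n) :=
  xget 0 [set P | is_isoproj la P]%classic.

Definition symmetriser (X : finType) (T : tpow R X n) : tpow R X n :=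
  (n`!%:R : C)^-1 *: \sum_p sact p T.

End Isotypic.

(* The equivariant projection exists and is unique, so the choice made in
   [isoproj] is a definite description. *)

Section IsoprojSpec.
Variables (R : realType) (n : nat) (X : finType) (la : seq nat).
Local Notation C := (R[i]).
Local Notation W := (tpow R X n).

Fact sact_linear (p : 'S_n) : linear (@sact R n X p).
Proof. by move=> a u v; apply/ffunP => x; rewrite !ffunE. Qed.
HB.instance Definition _ p :=
  GRing.isLinear.Build C W W _ (@sact R n X p) (sact_linear p).

Fact glact_linear g : linear (@glact R n X g).
Proof.
move=> a u v; apply/ffunP => x; rewrite !ffunE scaler_sumr -big_split /=.
by apply: eq_bigr => y _; rewrite !ffunE mulrDr /GRing.scale /= mulrCA.
Qed.
HB.instance Definition _ g :=
  GRing.isLinear.Build C W W _ (@glact R n X g) (glact_linear g).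

Lemma sact1 (T : W) : sact 1 T = T.
Proof.
apply/ffunP => x; rewrite !ffunE; congr (T _).
by apply/ffunP => i; rewrite ffunE perm1.
Qed.

Lemma sactM (p q : 'S_n) (T : W) : sact p (sact q T) = sact (q * p)%g T.
Proof.
apply/ffunP => x; rewrite !ffunE; congr (T _).
by apply/ffunP => i; rewrite !ffunE permM.
Qed.

Lemma glact_sact g p (T : W) : glact g (sact p T) = sact p (glact g T).
Proof.
apply/ffunP => x; rewrite !ffunE.
pose h (q : 'S_n) (y : {ffun 'I_n -> X}) : {ffun 'I_n -> X} :=
  [ffun i => y (q i)].
have hK q : cancel (h q) (h q^-1)%g.
  by move=> y; apply/ffunP => i; rewrite !ffunE permKV.
have hbij : bijective (h p) by exists (h p^-1)%g => //; rewrite -{2}(invgK p).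
rewrite [RHS](reindex (h p)) /=; last exact: onW_bij.
apply: eq_bigr => y _; rewrite ffunE; congr (_ * _).
rewrite (reindex_inj (@perm_inj _ p)) /=.
by apply: eq_bigr => i _; rewrite !ffunE.
Qed.

Definition avg (f : 'End(W)) : 'End(W) :=
  (n`!%:R : C)^-1 *: \sum_(p : 'S_n)
    (linfun (@sact R n X p^-1) \o f \o linfun (@sact R n X p))%VF.

Lemma avgE f (T : W) : 
  avg f T = (n`!%:R : C)^-1 *: \sum_(p : 'S_n) sact p^-1 (f (sact p T)).
Proof.
rewrite /avg scale_lfunE sum_lfunE; congr (_ *: _); apply: eq_bigr => p _.
by rewrite !comp_lfunE !lfunE.
Qed.

Lemma nfact0 : (n`!%:R : C) != 0.
Proof. by rewrite pnatr_eq0 -lt0n fact_gt0. Qed.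

Lemma sum_const (T : W) : (n`!%:R : C)^-1 *: (\sum_(p : 'S_n) T) = T.
Proof.
rewrite sumr_const card_Sn -(scaler_nat n`! (T : W)) scalerA mulVf ?scale1r //.
Qed.

Lemma avg_sact f q T : avg f (sact q T) = sact q (avg f T).
Proof.
rewrite !avgE linearZ /=; congr (_ *: _).
rewrite [RHS]linear_sum /= [RHS](reindex_inj (@mulgI _ q)) /=.
apply: eq_bigr => p _.
by rewrite !sactM invMg -mulgA mulVg mulg1.
Qed.

Definition sequiv (h : W -> W) := forall p T, h (sact p T) = sact p (h T).

Lemma equiv_inv (h : 'End(W)) : sequiv h ->
  exists s : 'End(W), sequiv s /\ forall T, h (s (h T)) = h T.
Proof.
move=> hh; exists (avg h^-1%VF); split; first by move=> p T; exact: avg_sact.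
move=> T; rewrite avgE linearZ linear_sum /=.
rewrite (eq_bigr (fun=> h T)) ?sum_const // => p _.
rewrite hh -(hh p T) limg_lfunVK ?memv_img ?memvf // hh sactM mulgV sact1 //.
Qed.

Lemma isotypic0 : @isotypic R n X la 0.
Proof. by exists 0%N, (fun=> 0), (fun=> 0); split=> [[]//|]; rewrite big_ord0. Qed.

Lemma isotypicD (T U : W) : isotypic la T -> isotypic la U -> isotypic la (T + U).
Proof.
move=> [m [f [a [fa ->]]]] [m' [g [b [gb ->]]]].
exists (m + m')%N, (fun i => match split i with inl j => f j | inr j => g j end),
  (fun i => match split i with inl j => a j | inr j => b j end); split.
  by move=> i; case: split => j; [exact: fa | exact: gb].
rewrite big_split_ord /=; congr (_ + _); apply: eq_bigr => i _.
  by rewrite (unsplitK (inl i)).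
by rewrite (unsplitK (inr i)).
Qed.

Lemma isotypic_im (h : 'End(W)) T : sequiv h -> isotypic la T -> isotypic la (h T).
Proof.
move=> hh [m [f [a [fa ->]]]]; exists m, (fun i => h \o f i)%VF, a; split.
  move=> i; have [fi ai] := fa i; split=> // p b sb.
  by rewrite !comp_lfunE fi // hh.
by rewrite linear_sum; apply: eq_bigr => i _; rewrite comp_lfunE.
Qed.

Lemma isotypicZ c (T : W) : isotypic la T -> isotypic la (c *: T).
Proof.
have -> : c *: T = (c *: \1%VF : 'End(W)) T by rewrite scale_lfunE id_lfunE.
by apply: isotypic_im => p U; rewrite !scale_lfunE !id_lfunE linearZ.
Qed.

Lemma isotypic_vs : exists U : {vspace W}, forall T, T \in U <-> isotypic la T.
Proof.
pose Q m := `[< exists U : {vspace W},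
  (forall T, T \in U -> isotypic la T) /\ \dim U = m >].
have exQ : exists m, Q m.
  exists 0%N; apply/asboolP; exists 0%VS; split; last exact: dimv0.
  by move=> T; rewrite memv0 => /eqP ->; exact: isotypic0.
have ubQ m : Q m -> (m <= \dim {: W})%N.
  by move=> /asboolP[U [_ <-]]; rewrite dimvS ?subvf.
case: (ex_maxnP exQ ubQ) => m /asboolP[U [UI dU]] mmax.
exists U => T; split; first exact: UI.
move=> IT; apply/negPn/negP => TU.
have : Q (\dim (U + <[T]>)).
  apply/asboolP; exists (U + <[T]>)%VS; split=> // V /memv_addP[u uU [v]].
  by move=> /vlineP[c ->] ->; apply: isotypicD; [exact: UI | exact: isotypicZ].
move=> /mmax; rewrite -dU => /(conj (addvSl U <[T]>%VS)) /andP.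
rewrite -eqEdim => /eqP UE; case/negP: TU.
by rewrite UE (subvP (addvSr _ _)) ?memv_line.
Qed.


Lemma isoproj_exists : exists P, @is_isoproj R n X la P.
Proof.
have [U UI] := isotypic_vs.
have Us p T : T \in U -> sact p T \in U.
  move=> /UI[m [f [a [fa ->]]]]; apply/UI.
  exists m, f, (fun i => galg_act p (a i)); split.
    move=> i; have [fi [b ab]] := fa i; split=> //; exists (galg_act p b).
    rewrite ab; apply/ffunP => s; rewrite !ffunE.
    rewrite [RHS](reindex_inj (@mulIg _ p)) /=; apply: eq_bigr => q _.
    by rewrite !ffunE mulgK invMg mulgA.
  rewrite linear_sum /=; apply: eq_bigr => i _; have [fi ai] := fa i.
  by rewrite fi.
pose P := avg (projv U).
have PU T : P T \in U.
  rewrite /P avgE memvZ // memv_suml // => p _; apply: Us; exact: memv_proj.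
have Pid T : T \in U -> P T = T.
  move=> TU; rewrite /P avgE (eq_bigr (fun=> T)) ?sum_const // => p _.
  by rewrite projv_id ?Us // sactM mulgV sact1.
have Peq : sequiv P by move=> p T; exact: avg_sact.
exists P; split=> //.
- move=> g T _; pose G := linfun (@glact R n X g).
  have GE V : G V = glact g V by rewrite lfunE.
  have Geq : sequiv G by move=> p V; rewrite !GE glact_sact.
  have GU V : V \in U -> G V \in U by move=> /UI VI; apply/UI/isotypic_im.
  pose h := (P \o G \o (\1 - P))%VF.
  have hE V : h V = P (G (V - P V)) by rewrite !comp_lfunE add_lfunE opp_lfunE id_lfunE.
  have heq : sequiv h.
    by move=> p V; rewrite !hE Peq -linearB /= Geq Peq.
  have [s [seq sh]] := equiv_inv heq.
  have h0 V : h V = 0.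
    rewrite -sh; have /UI hI : h V \in U by rewrite hE PU.
    have sU : s (h V) \in U by apply/UI/isotypic_im.
    by rewrite hE (Pid _ sU) subrr !linear0.
  have := h0 T; rewrite hE !linearB /= => /eqP; rewrite subr_eq0 !GE => /eqP ->.
  by rewrite -!GE (Pid (G (P T))) ?GU.
- by apply/lfunP => T; rewrite comp_lfunE Pid.
- move=> T; rewrite -UI; split=> [/memv_imgP[V _ ->]//|TU].
  by rewrite -(Pid _ TU) memv_img ?memvf.
Qed.

Lemma isoproj_uniq P Q : @is_isoproj R n X la P -> is_isoproj la Q -> P = Q.
Proof.
move=> [Peq _ PP PI] [Qeq _ QQ QI].
have PE T : P (P T) = P T by rewrite -comp_lfunE PP.
have QE T : Q (Q T) = Q T by rewrite -comp_lfunE QQ.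
have Pid T : isotypic la T -> P T = T.
  by move=> /PI/memv_imgP[V _ ->].
have Qid T : isotypic la T -> Q T = T.
  by move=> /QI/memv_imgP[V _ ->].
pose h := (P \o (\1 - Q))%VF.
have hE V : h V = P (V - Q V) by rewrite !comp_lfunE add_lfunE opp_lfunE id_lfunE.
have heq : sequiv h.
  by move=> p V; rewrite !hE Qeq -linearB /= Peq.
have [s [seq sh]] := equiv_inv heq.
apply/lfunP => T; have h0 : h T = 0.
  rewrite -sh; have hI : isotypic la (h T).
    by apply/PI; rewrite hE memv_img ?memvf.
  have sI : isotypic la (s (h T)) by exact: isotypic_im.
  by rewrite hE (Qid _ sI) subrr !linear0.
move: h0; rewrite hE linearB /= => /eqP; rewrite subr_eq0 => /eqP ->.
by rewrite Pid //; apply/QI; rewrite memv_img ?memvf.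
Qed.

Lemma isoprojP : is_isoproj la (isoproj R n X la).
Proof. exact: xgetPex isoproj_exists. Qed.

End IsoprojSpec.

(** * Tensors with k legs *)

Section Legs.
Variables (R : realType) (k : nat) (d : 'I_k -> nat).
Local Notation C := (R[i]).

Definition idx := {dffun forall j : 'I_k, 'I_(d j)}.

Definition idxS (S : {set 'I_k}) :=
  {dffun forall j : {j : 'I_k | j \in S}, 'I_(d (val j))}.

Definition resS (S : {set 'I_k}) (x : idx) : idxS S := [ffun j => x (val j)].

Fact notin_setC (S : {set 'I_k}) (j : 'I_k) : j \notin S -> j \in ~: S.
Proof. by rewrite inE. Qed.

Definition glue (S : {set 'I_k}) (x : idxS S) (y : idxS (~: S)) : idx :=
  [ffun j => match boolP (j \in S) with
             | AltTrue h => x (exist _ j h)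
             | AltFalse h => y (exist _ j (notin_setC h))
             end].

(* The tensor product of the spaces [C^(d j)]. *)
Definition tensor := cspace R idx.

(* [P (x) Id], along the splitting of the [n]-th tensor power given by [glue]. *)
Definition ext_id (n : nat) (S : {set 'I_k})
    (P : 'End(tpow R (idxS S) n)) (T : tpow R idx n) : tpow R idx n :=
  [ffun z : {ffun 'I_n -> idx} =>
     P [ffun x : {ffun 'I_n -> idxS S} =>
          T [ffun i => glue (x i) (resS (~: S) (z i))]]
       [ffun i => resS S (z i)]].

Definition tensor_pow (n : nat) (t : tensor) : tpow R idx n :=
  [ffun x : {ffun 'I_n -> idx} => \prod_i t (x i)].

Definition bipartition :=
  {b : {set {set 'I_k}} | partition b [set: 'I_k]%SET && (#|b| == 2%N)}.

(* A block of [b].  Both blocks give the same [bproj] and the same entropy of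
   the marginal. *)
Definition side (b : bipartition) : {set 'I_k} :=
  odflt finset.set0 [pick S in val b].

Definition bproj (n : nat) (b : bipartition) (la : seq nat)
    (T : tpow R idx n) : tpow R idx n :=
  ext_id (isoproj R n (idxS (side b)) la) (symmetriser T).

Definition is_prob (theta : {ffun bipartition -> R}) : Prop :=
  (forall b, 0 <= theta b) /\ \sum_b theta b = 1.

Definition E_upper (theta : {ffun bipartition -> R}) (s : seq bipartition)
    (t : tensor) : \bar R :=
  if t == 0 then -oo%E else
  ereal_sup [set e | exists (n : nat) (la : bipartition -> seq nat),
    [/\ (1 <= n)%N,
        forall b, b \in s -> is_part n (la b),
        foldl (fun T b => bproj b (la b) T) (tensor_pow n t) s != 0
      & e = (\sum_(b <- s) theta b * shannon_part R n (la b))%:E]]%classic.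

Definition density (psi : tensor) (x y : idx) : C :=
  psi x * conjc (psi y) / \sum_z psi z * conjc (psi z).

Definition marginal (psi : tensor) (S : {set 'I_k}) : 'M[C]_#|{: idxS S}| :=
  \matrix_(a, b) \sum_(c : idxS (~: S))
    density psi (glue (enum_val a) c) (glue (enum_val b) c).

Definition H_theta (theta : {ffun bipartition -> R}) (psi : tensor) : R :=
  \sum_b theta b * vN_entropy (marginal psi (side b)).

Definition local_act (A : forall j, 'M[C]_(d j)) (t : tensor) : tensor :=
  [ffun x : idx => \sum_(y : idx) (\prod_j A j (x j) (y j)) * t y].

Definition E_lower (theta : {ffun bipartition -> R}) (t : tensor) : \bar R :=
  if t == 0 then -oo%E else
  ereal_sup [set e | exists A : forall j, 'M[C]_(d j),
    (forall j, A j \in unitmx)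
    /\ e = (H_theta theta (local_act A t))%:E]%classic.

End Legs.

(* Main.v *)
(** Fix an invertible [A] and put [psi = A t].  The tensor powers of [A] commute
    with the isotypic projections, so it suffices to find partitions with
    [H(la/n) > H(rho_S) - eps] for which the iterated projection of
    [psi^{(x) n}] does not vanish.

    On [V_S^{(x) n}] the isotypic projections are orthogonal projections that
    add up to the identity: they are the actions of central elements of the
    group algebra of [S_n], multiples of the averaged Young symmetrisers.  The
    latter annihilate each other because of dominance, hence are linearly
    independent class functions, and there are as many of them as cycle types.

    The range of the projection for [la] has dimension at most
    [2^{n H(la/n)}] times a polynomial in [n].  On the other hand
    [rho_S^{(x) n}] puts, up to an exponentially small error, weight at most
    [2^{-n (H(rho_S) - delta)}] on each vector of its eigenbasis.  So the
    partitions with [H(la/n) <= H(rho_S) - eps] carry a total weight tending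
    to [0], the projection onto the other isotypic components moves
    [psi^{(x) n}] arbitrarily little, and so does the product of these
    projections over the bipartitions in the support of [theta]. *)

Require Import Defs.
From HB Require Import structures.
From mathcomp Require Import boolp reals ereal sequences exp.
From mathcomp Require Import all_boot all_order all_fingroup all_algebra.
From mathcomp Require Import complex spectral ring lra.

Set Implicit Arguments.
Unset Strict Implicit.
Unset Printing Implicit Defensive.

Import Order.TTheory GRing.Theory Num.Theory.

(** * Cycle types *)

Section CycleType.
Variable T : finType.
Implicit Types (p q : {perm T}) (x : T).

Definition orbits_by_size p : seq (seq T) :=
  sort (fun u v => size v <= size u)
    [seq fingraph.orbit p x | x <- enum (froots p)].

Definition cycle_type p : seq nat := shape (orbits_by_size p).

Definition cycle_enum p : seq T := flatten (orbits_by_size p).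

Lemma orbits_by_sizeP p u :
  u \in orbits_by_size p -> exists x, u = fingraph.orbit p x.
Proof. by rewrite mem_sort => /mapP[x _ ->]; exists x. Qed.

Lemma froot_orbit_inj p x y z : x \in froots p -> y \in froots p ->
  z \in fingraph.orbit p x -> z \in fingraph.orbit p y -> x = y.
Proof.
have sym : connect_sym (frel p) by exact/fconnect_sym/perm_inj.
move=> /eqP xx /eqP yy; rewrite -!fconnect_orbit => xz yz.
rewrite -xx -yy; apply/eqP; rewrite root_connect //.
by rewrite (connect_trans xz) // sym.
Qed.

Lemma cycle_enum_uniq p : uniq (cycle_enum p).
Proof.
have /perm_flatten/perm_uniq -> : perm_eq (orbits_by_size p)
  [seq fingraph.orbit p x | x <- enum (froots p)] by rewrite perm_sort.
have : {subset enum (froots p) <= froots p} by move=> x; rewrite mem_enum.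
elim: (enum _) (enum_uniq (froots p)) => //= x s IHs /andP[xs us] sub.
have subs : {subset s <= froots p} by move=> y ys; rewrite sub // inE ys orbT.
rewrite cat_uniq orbit_uniq IHs // andbT /=.
apply/hasPn => z /flattenP[_ /mapP[y ys ->]] zy; apply: contra xs => zx.
by rewrite (froot_orbit_inj (sub x (mem_head x s)) (subs y ys) zx zy).
Qed.

Lemma mem_cycle_enum p x : x \in cycle_enum p.
Proof.
have sym : connect_sym (frel p) by exact/fconnect_sym/perm_inj.
apply/flattenP; exists (fingraph.orbit p (froot p x)).
  by rewrite mem_sort map_f // mem_enum; exact: roots_root.
by rewrite -fconnect_orbit sym connect_root.
Qed.

Lemma size_cycle_enum p : size (cycle_enum p) = #|T|.
Proof.
rewrite -(card_uniqP (cycle_enum_uniq p)); apply: eq_card => x.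
by rewrite mem_cycle_enum.
Qed.

Lemma sumn_cycle_type p : sumn (cycle_type p) = #|T|.
Proof. by rewrite -size_flatten size_cycle_enum. Qed.

Lemma cycle_type_is_part p : is_part #|T| (cycle_type p).
Proof.
rewrite /is_part sumn_cycle_type eqxx andbT; apply/andP; split.
  by rewrite sorted_map; apply: sort_sorted => u v; exact: leq_total.
apply/negP => /mapP[_ /orbits_by_sizeP[x ->]]; rewrite size_orbit => e.
by have := fingraph.order_gt0 p x; rewrite -e.
Qed.

(* The successor of position [i] when an interval starting at [0] is cut into
   consecutive cycles of lengths [la]. *)
Definition next_pos (la : seq nat) (i : nat) : nat :=
  let r := reshape_index la i in
  let c := reshape_offset la i in
  flatten_index la r (if c.+1 < nth 0 la r then c.+1 else 0).

Lemma next_pos_lt la i : i < sumn la -> next_pos la i < sumn la.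
Proof.
move=> lti; apply: flatten_indexP.
by have := reshape_offsetP lti; case: ifP => // _; apply: leq_trans.
Qed.

Lemma perm_nth_cycle_enum p x0 i : i < #|T| ->
  p (nth x0 (cycle_enum p) i) =
  nth x0 (cycle_enum p) (next_pos (cycle_type p) i).
Proof.
rewrite -(sumn_cycle_type p) /next_pos; set la := cycle_type p => lti.
have := reshape_offsetP lti; have := reshape_indexP lti.
set r := reshape_index la i; set c := reshape_offset la i => ltr ltc.
have ltr' : r < size (orbits_by_size p) by move: ltr; rewrite size_map.
rewrite !nth_flatten -/la -/r -/c.
have ltc' : (if c.+1 < nth 0 la r then c.+1 else 0) < nth 0 la r.
  by case: ifP => // _; apply: leq_trans ltc.
rewrite flatten_indexKl // flatten_indexKr //.
have [x orbE] := orbits_by_sizeP (mem_nth [::] ltr').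
have lar : nth 0 la r = fingraph.order p x.
  by rewrite /la /cycle_type (nth_map [::]) // orbE size_orbit.
rewrite orbE; move: ltc ltc'; rewrite lar => ltc.
have nth_orbit j : j < fingraph.order p x ->
    nth x0 (fingraph.orbit p x) j = iter j p x.
  by move=> ltj; rewrite (set_nth_default x) ?size_orbit // nth_traject.
rewrite nth_orbit // -iterS; case: ifP => [ltSc _|ltSc ?];
  first by rewrite nth_orbit.
have -> : c.+1 = fingraph.order p x.
  by apply/eqP; rewrite eqn_leq ltc leqNgt ltSc.
by rewrite nth_orbit //=; apply/iter_order/perm_inj.
Qed.

(* The conjugating permutation matches the enumerations of the cycles. *)
Lemma cycle_type_conj p q :
  cycle_type p = cycle_type q -> exists g, q = (p ^ g)%g.
Proof.
move=> pq; pose match_enum x := nth x (cycle_enum q) (index x (cycle_enum p)).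
have lt_index s x : index x (cycle_enum s) < #|T|.
  by rewrite -(size_cycle_enum s) index_mem mem_cycle_enum.
have match_inj : injective match_enum.
  move=> x y /eqP.
  rewrite /match_enum (set_nth_default x y) ?size_cycle_enum //.
  rewrite nth_uniq ?cycle_enum_uniq ?size_cycle_enum // => /eqP e.
  by rewrite -(nth_index x (mem_cycle_enum p x)) e nth_index ?mem_cycle_enum.
exists (perm match_inj).
suff match_comm x : q (match_enum x) = match_enum (p x).
  apply/permP => x; rewrite -[x](permKV (perm match_inj)) permJ !permE.
  by rewrite match_comm.
rewrite /match_enum perm_nth_cycle_enum // -pq.
have lt_next : next_pos (cycle_type p) (index x (cycle_enum p)) < #|T|.
  by rewrite -(sumn_cycle_type p) next_pos_lt // sumn_cycle_type.
have -> : p x =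
    nth x (cycle_enum p) (next_pos (cycle_type p) (index x (cycle_enum p))).
  by rewrite -perm_nth_cycle_enum // nth_index ?mem_cycle_enum.
rewrite index_uniq ?size_cycle_enum ?cycle_enum_uniq //.
by apply: set_nth_default; rewrite size_cycle_enum.
Qed.

End CycleType.

(** * Dominance of partitions *)

Section Partitions.
Implicit Types la mu : seq nat.

Lemma sumn_take_S la r : sumn (take r.+1 la) = sumn (take r la) + nth 0 la r.
Proof.
have [ltr|ler] := ltnP r (size la); first by rewrite (take_nth 0) // sumn_rcons.
by rewrite !take_oversize ?nth_default ?addn0 // leqW.
Qed.

Lemma leq_sumn_take la r s : r <= s -> sumn (take r la) <= sumn (take s la).
Proof. by move=> rs; rewrite -(subnKC rs) takeD sumn_cat leq_addr. Qed.

Lemma sumn_take_le la r : sumn (take r la) <= sumn la.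
Proof. by rewrite -{2}(cat_take_drop r la) sumn_cat leq_addr. Qed.

Lemma nth_le_sumn la i : nth 0 la i <= sumn la.
Proof.
by apply: leq_trans (sumn_take_le la i.+1); rewrite sumn_take_S leq_addl.
Qed.

Lemma sorted_geq_nth la i j : sorted geq la -> i <= j ->
  nth 0 la j <= nth 0 la i.
Proof.
move=> la_s le_ij; have [ltj|gej] := ltnP j (size la);
  last by rewrite nth_default.
have geq_trans : transitive geq.
  by move=> a b c /= ab ca; apply: leq_trans ca ab.
by apply: (sorted_leq_nth geq_trans leqnn) => //;
  rewrite inE (leq_ltn_trans le_ij).
Qed.

Definition dominates la mu := forall r, sumn (take r mu) <= sumn (take r la).

Lemma dominates_anti la mu : 0 \notin la -> 0 \notin mu ->
  dominates la mu -> dominates mu la -> la = mu.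
Proof.
move=> la0 mu0 la_mu mu_la.
have takeE r : sumn (take r la) = sumn (take r mu).
  by apply/eqP; rewrite eqn_leq la_mu mu_la.
have nthE r : nth 0 la r = nth 0 mu r.
  apply/eqP; rewrite -(eqn_add2l (sumn (take r la))) {2}takeE.
  by rewrite -!sumn_take_S takeE.
have size_le u v : 0 \notin u -> nth 0 u =1 nth 0 v -> size u <= size v.
  move=> u0 uv; rewrite leqNgt; apply: contra u0 => lt.
  by rewrite -(nth_default 0 (leqnn (size v))) -uv mem_nth.
apply: (@eq_from_nth _ 0) => [|r _]; last exact: nthE.
by apply/eqP; rewrite eqn_leq !size_le // => r.
Qed.

Lemma reshape_index_lt la i r : i < sumn la ->
  (reshape_index la i < r) = (i < sumn (take r la)).
Proof.
move=> lti; have := reshape_offsetP lti; have := reshape_indexK la i.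
rewrite /flatten_index; set k := reshape_index la i => e ltc; apply/idP/idP.
  move/(leq_sumn_take la); apply: leq_trans.
  by rewrite sumn_take_S -[X in X < _]e ltn_add2l.
apply: contraLR; rewrite -!leqNgt => /(leq_sumn_take la) le_rk.
by apply: leq_trans le_rk _; rewrite -[X in _ <= X]e leq_addr.
Qed.

Lemma box_inj la i j : reshape_index la i = reshape_index la j ->
  reshape_offset la i = reshape_offset la j -> i = j.
Proof.
by move=> ri ci; rewrite -(reshape_indexK la i) -(reshape_indexK la j) ri ci.
Qed.

End Partitions.

Section YoungDiagram.
Variables (n : nat) (la : seq nat).
Hypothesis sum_la : sumn la = n.
Implicit Types (r c : nat) (i j : 'I_n).

Lemma flatten_index_lt r c : c < nth 0 la r -> flatten_index la r c < n.
Proof. by move/flatten_indexP; rewrite sum_la. Qed.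

Definition box_at r c (in_row : c < nth 0 la r) : 'I_n :=
  Ordinal (flatten_index_lt in_row).

Lemma box_at_row r c (in_row : c < nth 0 la r) :
  reshape_index la (box_at in_row) = r.
Proof. exact: flatten_indexKl. Qed.

Lemma box_at_col r c (in_row : c < nth 0 la r) :
  reshape_offset la (box_at in_row) = c.
Proof. exact: flatten_indexKr. Qed.

Lemma card_rows_lt r :
  #|[set i : 'I_n | reshape_index la i < r]| = sumn (take r la).
Proof.
have le_n : sumn (take r la) <= n by rewrite -sum_la sumn_take_le.
have widen_inj : injective (widen_ord le_n).
  by move=> i j /(congr1 val) /= /val_inj.
rewrite -[RHS]card_ord -(card_imset _ widen_inj).
apply: eq_card => i; rewrite !inE reshape_index_lt ?sum_la //.
apply/idP/imsetP => [lti|[j _ ->]]; last by rewrite /= ltn_ord.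
by exists (Ordinal lti) => //; apply: val_inj.
Qed.

Lemma card_row r : #|[set i : 'I_n | reshape_index la i == r]| = nth 0 la r.
Proof.
apply/eqP; rewrite -(eqn_add2l (sumn (take r la))) -sumn_take_S.
rewrite -!card_rows_lt -cardsUI (_ : _ :&: _ = finset.set0)%SET; last first.
  by apply/setP => i; rewrite !inE; case: ltngtP.
rewrite cards0 addn0; apply/eqP/eq_card => i.
by rewrite !inE ltnS [RHS]leq_eqVlt orbC.
Qed.

Lemma card_by_column (P : pred 'I_n) :
  #|[set i | P i]| =
  \sum_(c < n) #|[set i : 'I_n | P i & reshape_offset la i == c]|.
Proof.
pose col i : 'I_n := Ordinal (leq_ltn_trans (leq_subr _ _) (ltn_ord i) :
  reshape_offset la i < n).
rewrite -sum1_card (partition_big col xpredT) //=; apply: eq_bigr => c _.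
by rewrite -sum1_card; apply: eq_bigl => i; rewrite !inE.
Qed.

(* The columns of a Young diagram have no gaps. *)
Lemma minn_card_column r c : sorted geq la ->
  minn r #|[set i : 'I_n | reshape_offset la i == c]| <=
  #|[set i : 'I_n | reshape_index la i < r & reshape_offset la i == c]|.
Proof.
move=> la_s; have [all_long|] := boolP [forall k : 'I_r, c < nth 0 la k].
  pose box k := box_at (forallP all_long k).
  have inj_box : injective box.
    move=> k l /(congr1 (fun i : 'I_n => reshape_index la i)).
    by rewrite !box_at_row => /val_inj.
  rewrite geq_min -[X in X <= _]card_ord -(card_imset _ inj_box).
  rewrite subset_leq_card //; apply/subsetP => _ /imsetP[k _ ->].
  by rewrite !inE box_at_row box_at_col ltn_ord eqxx.
rewrite negb_forall => /existsP[k]; rewrite -leqNgt => la_k.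
rewrite geq_min orbC subset_leq_card //; apply/subsetP => i; rewrite !inE => ic.
rewrite ic andbT; apply: leq_trans (ltn_ord k); rewrite ltnS leqNgt.
apply/negP => lt_ki; have lti : i < sumn la by rewrite sum_la.
have := reshape_offsetP lti; rewrite (eqP ic) ltnNge => /negP[].
exact: leq_trans (sorted_geq_nth la_s (ltnW lt_ki)) la_k.
Qed.

End YoungDiagram.

(* The first [r] rows of [mu], moved by [g], meet each column of [la] in at most
   [r] boxes. *)
Lemma dominates_of_transversal n la mu (g : 'S_n) :
  sumn la = n -> sumn mu = n -> sorted geq la ->
  (forall i j : 'I_n, reshape_index mu (g i) = reshape_index mu (g j) ->
     reshape_offset la i = reshape_offset la j -> i = j) ->
  dominates la mu.
Proof.
move=> sum_la sum_mu la_s transversal r.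
rewrite -(card_rows_lt sum_la) -(card_rows_lt sum_mu).
rewrite -(card_preimset _ (@perm_inj _ g)).
rewrite -[X in X <= _]cardsE (card_by_column la) [leqRHS](card_by_column la).
apply: leq_sum => c _; apply: leq_trans (minn_card_column sum_la r c la_s).
rewrite leq_min andbC subset_leq_card /=; last first.
  by apply/subsetP => i; rewrite !inE => /andP[].
have [->|r0] := posnP r; first by rewrite eq_card0 // => i; rewrite !inE.
pose row i : 'I_r.-1.+1 := inord (reshape_index mu (g i)).
rewrite -[X in _ <= X](prednK r0) -[X in _ <= X]card_ord.
rewrite -(@card_in_imset _ _ row) ?max_card // => i j; rewrite !inE.
move=> /andP[ir /eqP ic] /andP[jr /eqP jc] /(congr1 val) /=.
by rewrite !inordK ?prednK // => rowE; apply: transversal; rewrite ?ic ?jc.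
Qed.

Lemma size_short_parts n d (L : seq (seq nat)) : uniq L ->
  (forall la, la \in L -> is_part n la && (size la <= d)) ->
  size L <= n.+1 ^ d.
Proof.
move=> uL L_short; pose entries (la : seq nat) : {ffun 'I_d -> 'I_n.+1} :=
  [ffun k : 'I_d => inord (nth 0 la k)].
rewrite -(size_map entries).
rewrite -[X in _ <= X ^ _]card_ord -[X in _ <= _ ^ X]card_ord.
rewrite -card_ffun -(card_uniqP _) ?max_card // map_inj_in_uniq //.
move=> la mu /L_short/andP[/and3P[_ la0 /eqP sum_la] la_d].
move=> /L_short/andP[/and3P[_ mu0 /eqP sum_mu] mu_d] /ffunP entriesE.
have nthE k : nth 0 la k = nth 0 mu k.
  have [ltk|gek] := ltnP k d; last by rewrite !nth_default // (leq_trans _ gek).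
  have := congr1 val (entriesE (Ordinal ltk)).
  rewrite !ffunE /= !inordK // ltnS -?sum_la ?nth_le_sumn //.
  by rewrite sum_la -sum_mu nth_le_sumn.
have takeE r : sumn (take r la) = sumn (take r mu).
  by elim: r => [|r IHr]; rewrite ?take0 // !sumn_take_S IHr nthE.
by apply: dominates_anti => // r; rewrite takeE.
Qed.

Local Open Scope ring_scope.

(** * Orthogonal projections *)

Section OrthogonalProjections.
Variables (C : numClosedFieldType) (U : lmodType C)
  (form : {dot U for Num.conj}).
Local Notation "''[' u , v ]" := (form u v) : ring_scope.
Local Notation "''[' u ]" := '[u, u] : ring_scope.
Implicit Types (u v : U) (f : {linear U -> U}).

Definition orth_proj (f : U -> U) : Prop :=
  (forall u, f (f u) = f u) /\ (forall u v, '[f u, v] = '[u, f v]).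

Lemma dnorm_orth_proj f u : orth_proj f -> '[f u] = '[f u, u].
Proof. by move=> [idem adj]; rewrite -adj idem. Qed.

Lemma orth_proj_ortho f u v : orth_proj f -> '[u - f u, f v] = 0.
Proof. by move=> [idem adj]; rewrite -adj linearB /= idem subrr linear0l. Qed.

Lemma dnorm_orth_proj_le f u : orth_proj f -> '[f u] <= '[u].
Proof.
move=> fP; rewrite -[X in _ <= '[X]](subrK (f u)) hnormDd.
  by rewrite lerDr dnorm_ge0.
exact: orth_proj_ortho.
Qed.

Section Family.
Variables (J : eqType) (f : J -> {linear U -> U}) (s : seq J).
Hypothesis uniq_s : uniq s.
Hypothesis f_proj : forall j, j \in s -> orth_proj (f j).
Hypothesis f_ortho : forall i j u, i \in s -> j \in s -> i != j ->
  f i (f j u) = 0.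

Lemma orth_proj_sum : orth_proj (fun u => \sum_(j <- s) f j u).
Proof.
split=> [u|u v]; last first.
  by rewrite linear_sumlz linear_sumr; apply: eq_big_seq => j /f_proj[_]; apply.
apply: eq_big_seq => i si; rewrite linear_sum (bigD1_seq i) //= big1_seq ?addr0.
  by have [] := f_proj si.
by move=> j /andP[ji sj]; rewrite f_ortho // eq_sym.
Qed.

Lemma dnorm_sum_orth_proj u : '[\sum_(j <- s) f j u] = \sum_(j <- s) '[f j u].
Proof.
rewrite linear_sumlz; apply: eq_big_seq => i si.
rewrite linear_sumr (bigD1_seq i) //=.
rewrite big1_seq ?addr0 // => j /andP[ji sj]; have [_ adj] := f_proj si.
by rewrite adj f_ortho ?linear0r // eq_sym.
Qed.

End Family.

(* Orthogonality of [u - f j u] and the range of [f j] lets the defects add up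
   without any square root. *)
Lemma gentle_measurement (J : eqType) (f : J -> {linear U -> U}) (s : seq J) u :
  (forall j, j \in s -> orth_proj (f j)) ->
  '[u - foldl (fun v j => f j v) u s] <= \sum_(j <- s) '[u - f j u].
Proof.
elim/last_ind: s => [|s j IHs] f_proj; first by rewrite big_nil subrr linear0l.
have fjP : orth_proj (f j) by apply: f_proj; rewrite mem_rcons mem_head.
rewrite foldl_rcons -cats1 big_cat big_seq1 [leRHS]addrC /=.
set v := foldl _ _ _ in IHs *.
have -> : u - f j v = (u - f j u) + f j (u - v).
  by rewrite linearB /= addrA subrK.
rewrite hnormDd ?lerD2l; last exact: orth_proj_ortho.
apply: le_trans (dnorm_orth_proj_le _ fjP) _; apply: IHs => i si.
by apply: f_proj; rewrite mem_rcons inE si orbT.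
Qed.

End OrthogonalProjections.

Section CoordinateSpace.
Variables (R : realType) (I : finType).
Local Notation C := R[i].
Implicit Types (T U : cspace R I) (x y : I).

Definition dot T U : C := \sum_x T x * (U x : C)^*.

Fact dot_bilinear :
  bilinear_for ( *%R : GRing.Scale.law C C)
    (Num.conj \; *%R : GRing.Scale.law C C) dot.
Proof.
split=> [U c T T'|T c U U'];
  rewrite /dot /= mulr_sumr -big_split; apply: eq_bigr => x _.
  by rewrite !ffunE mulrDl mulrA.
by rewrite !ffunE [c *: _]/(c * _) rmorphD rmorphM mulrDr mulrCA.
Qed.
HB.instance Definition _ :=
  bilinear_isBilinear.Build C (cspace R I) (cspace R I) C
    *%R (Num.conj \; *%R) dot dot_bilinear.

Fact dot_hermitian T U : dot T U = (-1) ^+ false * (dot U T)^*.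
Proof.
rewrite mul1r rmorph_sum; apply: eq_bigr => x _.
by rewrite rmorphM /= conjCK mulrC.
Qed.
HB.instance Definition _ :=
  isHermitianSesquilinear.Build C (cspace R I) false Num.conj dot dot_hermitian.

Fact dot_gt0 T : T != 0 -> 0 < dot T T.
Proof.
apply: contra_neqT => Tgt0; apply/ffunP => x; rewrite ffunE; apply/eqP.
have : dot T T == 0.
  by move: Tgt0; rewrite lt_def sumr_ge0 ?andbT ?negbK // => y _;
    exact: mul_conjC_ge0.
rewrite psumr_eq0 => [/allP/(_ x (mem_index_enum x))|y _];
  last exact: mul_conjC_ge0.
by rewrite mul_conjC_eq0.
Qed.
HB.instance Definition _ := isDotProduct.Build C (cspace R I) dot dot_gt0.

Definition basis_vec x : cspace R I := [ffun y => (y == x)%:R : C].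

Lemma basis_vecE T : T = \sum_x (T x : C) *: basis_vec x.
Proof.
apply/ffunP => y; rewrite sum_ffunE (bigD1 y) //= big1 => [|x /negPf xy].
  by rewrite addr0 !ffunE eqxx [_ *: _]mulr1.
by rewrite !ffunE eq_sym xy [_ *: _]mulr0.
Qed.

Lemma dot_basis_vec T x : dot T (basis_vec x) = T x.
Proof.
rewrite /dot (bigD1 x) //= big1 => [|y /negPf yx]; last first.
  by rewrite ffunE yx rmorph0 mulr0.
by rewrite ffunE eqxx rmorph1 mulr1 addr0.
Qed.

End CoordinateSpace.

Local Notation "''[' T , U ]" := (dot T U) : ring_scope.
Local Notation "''[' T ]" := '[T, T] : ring_scope.

Section DiagonalEntries.
Variables (R : realType) (I : finType) (f : {linear cspace R I -> cspace R I}).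
Local Notation C := R[i].
Local Notation e_ := (@basis_vec R I).

Hypothesis f_proj : orth_proj (@dot R I) f.

Lemma orth_proj_diag x : f (e_ x) x = '[f (e_ x)].
Proof. by rewrite dnorm_orth_proj //= dot_basis_vec. Qed.

Lemma orth_proj_diag_ge0 x : 0 <= (f (e_ x) x : C).
Proof. by rewrite orth_proj_diag dnorm_ge0. Qed.

Lemma orth_proj_diag_le1 x : (f (e_ x) x : C) <= 1.
Proof.
rewrite orth_proj_diag; apply: le_trans (dnorm_orth_proj_le _ f_proj) _.
by rewrite /= dot_basis_vec ffunE eqxx.
Qed.

End DiagonalEntries.

Lemma mxtrace_idem (F : fieldType) m (M : 'M[F]_m) :
  M *m M = M -> \tr M = (\rank M)%:R.
Proof.
move=> MM; have base1 : row_base M *m col_base M = 1%:M.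
  apply: (row_free_inj (row_base_free M)); rewrite mul1mx.
  have col_free : row_free (col_base M)^T.
    by rewrite -row_leq_rank mxrank_tr (eqP (col_base_full M)).
  apply: trmx_inj; apply: (row_free_inj col_free).
  rewrite -!trmx_mul -(mulmxA (row_base M)) mulmx_base.
  by rewrite (mulmxA (col_base M)) mulmx_base MM.
by rewrite -{1}(mulmx_base M) mxtrace_mulC base1 mxtrace1.
Qed.

Lemma sum_enum_rank (V : nmodType) (I : finType) (F : 'I_#|I| -> V) :
  \sum_(a < #|I|) F a = \sum_x F (enum_rank x).
Proof. by rewrite (reindex (@enum_rank I)) //; exact/onW_bij/enum_rank_bij. Qed.

Section TraceOfIdempotent.
Variables (R : realType) (I : finType) (f : {linear cspace R I -> cspace R I}).
Local Notation C := R[i].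
Local Notation e_ := (@basis_vec R I).

Lemma trace_idem_le (vs : seq (cspace R I)) :
  (forall T, f (f T) = f T) -> (forall T, f T \in <<vs>>%VS) ->
  \sum_x (f (e_ x) x : C) <= (size vs)%:R.
Proof.
move=> idem range.
pose M : 'M[C]_#|I| := \matrix_(a, b) f (e_ (enum_val b)) (enum_val a).
have -> : \sum_x (f (e_ x) x : C) = \tr M.
  by rewrite [RHS]sum_enum_rank; apply: eq_bigr => x _; rewrite mxE enum_rankK.
rewrite mxtrace_idem; last first.
  apply/matrixP => a b; rewrite !mxE -[in RHS]idem.
  rewrite [in RHS](basis_vecE (f (e_ (enum_val b)))) linear_sum.
  rewrite sum_ffunE sum_enum_rank.
  by apply: eq_bigr => x _; rewrite !mxE enum_rankK linearZ ffunE mulrC.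
pose A : 'M[C]_(#|I|, size vs) := \matrix_(a, k) vs`_k (enum_val a).
pose B : 'M[C]_(size vs, #|I|) :=
  \matrix_(k, b) coord (in_tuple vs) k (f (e_ (enum_val b))).
have -> : M = A *m B.
  apply/matrixP => a b; rewrite !mxE.
  rewrite (@coord_span _ _ _ (in_tuple vs) _ (range _)).
  by rewrite sum_ffunE; apply: eq_bigr => k _; rewrite !mxE ffunE [_ *: _]mulrC.
by rewrite ler_nat (leq_trans (mxrankM_maxl _ _)) ?rank_leq_col.
Qed.

End TraceOfIdempotent.

(** * The group algebra acting on tensor powers *)

Section GroupAlgebraAction.
Variables (R : realType) (n : nat).
Local Notation C := R[i].
Local Notation galg := (galg R n).
Implicit Types (a b : galg) (p q s g h : 'S_n).

Definition galgact (X : finType) a (T : tpow R X n) : tpow R X n :=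
  \sum_p (a p : C) *: sact p T.

Section FixedAlphabet.
Variable X : finType.
Local Notation W := (tpow R X n).
Implicit Types T U : W.

Fact galgact_bilinear :
  bilinear_for ( *:%R : GRing.Scale.law C W) ( *:%R : GRing.Scale.law C W)
    (@galgact X).
Proof.
split=> [T c a b|a c T U]; rewrite /galgact /= scaler_sumr -big_split.
  by apply: eq_bigr => p _; rewrite !ffunE scalerDl scalerA.
by apply: eq_bigr => p _; rewrite linearP scalerDr !scalerA mulrC.
Qed.
HB.instance Definition _ :=
  bilinear_isBilinear.Build C galg W W *:%R *:%R (@galgact X) galgact_bilinear.
HB.instance Definition _ a :=
  GRing.isLinear.Build C W W _ (@galgact X a) (galgact_bilinear.2 a).

Lemma galgact_basis_vec p T : galgact (basis_vec R p) T = sact p T.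
Proof.
rewrite /galgact (bigD1 p) //= ffunE eqxx scale1r big1 ?addr0 // => q /negPf qp.
by rewrite ffunE qp scale0r.
Qed.

Lemma galgact_galg_act p a T : galgact (galg_act p a) T = sact p (galgact a T).
Proof.
rewrite /galgact linear_sum (reindex_inj (mulIg p)); apply: eq_bigr => s _ /=.
by rewrite ffunE mulgK linearZ /= sactM.
Qed.

Lemma galg_mulE a b : galg_mul a b = \sum_p (a p : C) *: galg_act p b.
Proof.
by apply/ffunP => s; rewrite sum_ffunE ffunE; apply: eq_bigr => p _;
  rewrite !ffunE.
Qed.

Lemma galgact_mul a b T : galgact (galg_mul a b) T = galgact a (galgact b T).
Proof.
rewrite galg_mulE linear_sumlz; apply: eq_bigr => p _.
by rewrite linearZl_LR /= galgact_galg_act.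
Qed.

Lemma galgact_equivariant a (h : {linear W -> W}) T :
  sequiv h -> h (galgact a T) = galgact a (h T).
Proof.
by move=> h_eq; rewrite linear_sum; apply: eq_bigr => p _;
  rewrite linearZ /= h_eq.
Qed.

Lemma galgact_glact a (M : 'M[C]_#|X|) T :
  galgact a (glact M T) = glact M (galgact a T).
Proof. by rewrite galgact_equivariant // => p U; exact: glact_sact. Qed.

Definition class_fun a : Prop := forall s g, a (s ^ g)%g = a s.

Lemma class_fun_equivariant a : class_fun a -> sequiv (@galgact X a).
Proof.
move=> a_class h T; rewrite /galgact linear_sum.
rewrite [LHS](reindex_inj (conjg_inj h)) /=.
apply: eq_bigr => s _; rewrite a_class linearZ /= !sactM.
by rewrite conjgE !mulgA mulgV mul1g.
Qed.

Lemma class_fun_galgactC a b T :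
  class_fun a -> galgact a (galgact b T) = galgact b (galgact a T).
Proof. by move=> a_class; apply/galgact_equivariant/class_fun_equivariant. Qed.

Lemma dot_sact p T U : '[sact p T, U] = '[T, sact p^-1 U].
Proof.
have wordK q : cancel (fun x : {ffun 'I_n -> X} => [ffun i => x (q i)])
                      (fun x : {ffun 'I_n -> X} => [ffun i => x (q^-1%g i)]).
  by move=> x; apply/ffunP => i; rewrite !ffunE permKV.
rewrite [RHS](reindex_inj (can_inj (wordK p))); apply: eq_bigr => x _.
by rewrite [sact p T x]ffunE [sact p^-1 U _]ffunE wordK.
Qed.

Lemma dot_galgact a T U : (forall s, (a s^-1%g : C) = (a s : C)^*) ->
  '[galgact a T, U] = '[T, galgact a U].
Proof.
move=> a_adj; rewrite linear_sumlz linear_sumr [RHS](reindex_inj invg_inj).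
apply: eq_bigr => p _; rewrite linearZl_LR linearZr_LR /=.
by rewrite dot_sact a_adj conjCK.
Qed.

End FixedAlphabet.

Definition perm_word s : {ffun 'I_n -> 'I_n} := [ffun i => s i].

Lemma galgact_perm_word a s :
  galgact a (basis_vec R (perm_word 1)) (perm_word s) = a s^-1%g.
Proof.
rewrite /galgact sum_ffunE (bigD1 s^-1%g) //= big1 => [|p].
  rewrite addr0 !ffunE (_ : _ == _) ?[_ *: _]mulr1 //.
  by apply/eqP/ffunP => i; rewrite !ffunE permKV perm1.
move=> ps; rewrite !ffunE (_ : _ == _ = false) ?[_ *: _]mulr0 //.
apply: contra_neqF ps => /eqP/ffunP ps1; apply/eqP; rewrite -mulg_eq1.
by apply/eqP/permP => i; have := ps1 i; rewrite !ffunE permM.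
Qed.

Lemma galgact_inj a b :
  (forall T : tpow R 'I_n n, galgact a T = galgact b T) -> a = b.
Proof.
by move=> ab; apply/ffunP => s; rewrite -[s]invgK -!galgact_perm_word ab.
Qed.

End GroupAlgebraAction.

(** * Young symmetrisers *)

Section LabelStabiliser.
Variables (T : finType) (L : eqType) (c : T -> L).
Implicit Types (p q : {perm T}) (x y : T).

Definition label_stab p : bool := [forall x, c (p x) == c x].

Lemma label_stabP p : reflect (forall x, c (p x) = c x) (label_stab p).
Proof. exact: 'forall_eqP. Qed.

Lemma label_stab1 : label_stab 1%g.
Proof. by apply/label_stabP => x; rewrite perm1. Qed.

Lemma label_stabV p : label_stab p^-1%g = label_stab p.
Proof.
apply/label_stabP/label_stabP => cp x; first by rewrite -(cp (p x)) permK.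
by rewrite -[LHS]cp permKV.
Qed.

Lemma label_stabMl p q : label_stab p -> label_stab (p * q)%g = label_stab q.
Proof.
move=> /label_stabP cp; apply/label_stabP/label_stabP => cq x.
  by rewrite -[x in LHS](permKV p) -permM cq -[LHS]cp permKV.
by rewrite permM cq cp.
Qed.

Lemma label_stabMr p q : label_stab q -> label_stab (p * q)%g = label_stab p.
Proof. by move=> cq; rewrite -label_stabV invMg label_stabMl label_stabV. Qed.

Lemma label_stab_tperm x y : c x = c y -> label_stab (tperm x y).
Proof.
by move=> cxy; apply/label_stabP => z; case: tpermP => [->|->|] //; rewrite cxy.
Qed.

End LabelStabiliser.

Section YoungStabilisers.
Variables (n : nat) (la : seq nat).
Implicit Types (p : 'S_n).

Lemma row_stabE p :
  row_stab la p = label_stab (fun i : 'I_n => reshape_index la i) p.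
Proof. by []. Qed.

Lemma col_stabE p :
  col_stab la p = label_stab (fun i : 'I_n => reshape_offset la i) p.
Proof. by []. Qed.

Lemma row_col_stab_eq1 p : row_stab la p -> col_stab la p -> p = 1%g.
Proof.
move=> /label_stabP rp /label_stabP cp; apply/permP => i; rewrite perm1.
by apply: val_inj; apply: (@box_inj la); [exact: rp | exact: cp].
Qed.

End YoungStabilisers.

Section YoungSymmetriser.
Variables (R : realType) (n : nat) (X : finType).
Local Notation C := R[i].
Local Notation W := (tpow R X n).
Implicit Types (T : W) (la mu : seq nat) (p q h : 'S_n) (i j : 'I_n).

Definition row_sym la T : W := \sum_(p | row_stab la p) sact p T.

Definition col_antisym la T : W :=
  \sum_(q | col_stab la q) ((-1) ^+ odd_perm q : C) *: sact q T.

Fact row_sym_linear la : linear (row_sym la).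
Proof.
move=> c T U; rewrite /row_sym scaler_sumr -big_split.
by apply: eq_bigr => p _; rewrite linearP.
Qed.
HB.instance Definition _ la :=
  GRing.isLinear.Build C W W _ (row_sym la) (row_sym_linear la).

Fact col_antisym_linear la : linear (col_antisym la).
Proof.
move=> c T U; rewrite /col_antisym scaler_sumr -big_split.
apply: eq_bigr => q _ /=.
by rewrite linearP scalerDr !scalerA mulrC.
Qed.
HB.instance Definition _ la :=
  GRing.isLinear.Build C W W _ (col_antisym la) (col_antisym_linear la).

Lemma galgact_young_sym la T :
  galgact (young_sym R n la) T = row_sym la (col_antisym la T).
Proof.
rewrite /galgact; under eq_bigr => s _ do rewrite ffunE scaler_suml.
rewrite exchange_big; apply: eq_bigr => p _ /=; rewrite linear_sum /=.
under eq_bigr => s _ do rewrite scaler_suml.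
rewrite exchange_big; apply: eq_bigr => q _ /=.
rewrite (bigD1 (q * p)%g) //= big1 ?addr0 => [|s /negPf ->]; last first.
  by rewrite mulr0 scale0r.
by rewrite eqxx mulr1 linearZ /= sactM.
Qed.

Lemma sact_row_sym la p T : row_stab la p ->
  sact p (row_sym la T) = row_sym la T.
Proof.
move=> rp; rewrite /row_sym linear_sum [RHS](reindex_inj (mulIg p)) /=.
by apply: eq_big => [q|q _]; rewrite ?row_stabE ?label_stabMr ?sactM.
Qed.

Lemma sact_col_antisym la q T : col_stab la q ->
  sact q (col_antisym la T) = (-1) ^+ odd_perm q *: col_antisym la T.
Proof.
move=> cq; rewrite /col_antisym linear_sum scaler_sumr.
rewrite [RHS](reindex_inj (mulIg q)).
apply: eq_big => [p|p _ /=]; first by rewrite !col_stabE label_stabMr.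
rewrite linearZ /= sactM scalerA -signr_addb odd_permM.
by rewrite addbC -addbA addbb addbF.
Qed.

Lemma col_antisym_sact la q T : col_stab la q ->
  col_antisym la (sact q T) = (-1) ^+ odd_perm q *: col_antisym la T.
Proof.
move=> cq; rewrite /col_antisym scaler_sumr [RHS](reindex_inj (mulgI q)).
apply: eq_big => [p|p _ /=]; first by rewrite !col_stabE label_stabMl.
by rewrite sactM scalerA -signr_addb odd_permM addbA addbb addFb.
Qed.

(* Two boxes in a common row of [mu] and a common column of [la] are exchanged
   by a transposition that fixes the row symmetriser and negates the column
   antisymmetriser. *)
Lemma col_antisym_row_sym0 la mu h T :
  is_part n la -> is_part n mu -> ~ dominates la mu ->
  col_antisym la (sact h (row_sym mu T)) = 0.
Proof.
move=> /and3P[la_s _ /eqP sum_la] /and3P[_ _ /eqP sum_mu] ndom.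
apply: contrapT => ne0; apply: ndom.
apply: (dominates_of_transversal (g := h^-1%g) sum_la sum_mu la_s).
move=> i j rij cij.
apply/eqP/negPn/negP => ij; apply: ne0; set U := sact h _.
have fixU : sact (tperm i j) U = U.
  rewrite sactM.
  have -> : (h * tperm i j = tperm (h^-1 i) (h^-1 j) * h)%g.
    by rewrite -tpermJ /conjg invgK !mulgA mulgKV.
  by rewrite -sactM sact_row_sym // row_stabE label_stab_tperm.
have c_ij : col_stab la (tperm i j) by rewrite col_stabE label_stab_tperm.
have := col_antisym_sact U c_ij; rewrite fixU odd_tperm ij scaleN1r => /eqP.
by rewrite -addr_eq0 -mulr2n -scaler_nat scaler_eq0 pnatr_eq0 => /eqP.
Qed.

Lemma col_antisym_long0 la T :
  is_part n la -> (#|X| < size la)%N -> col_antisym la T = 0.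
Proof.
move=> /and3P[_ la0 /eqP sum_la] long; apply/ffunP => x; rewrite [RHS]ffunE.
have la_gt0 (r : 'I_(size la)) : (0 < nth 0%N la r)%N.
  by rewrite lt0n; apply: contraNneq la0 => <-; exact: mem_nth.
pose first r := box_at sum_la (la_gt0 r).
have /injectivePn[r [s rs xrs]] : ~~ injectiveb (fun r => x (first r)).
  by apply/negP => /injectiveP/leq_card; rewrite card_ord leqNgt long.
have ne : first r != first s.
  apply: contraNneq rs => /(congr1 (fun i : 'I_n => reshape_index la i)).
  by rewrite !box_at_row => /val_inj ->.
have same_col : col_stab la (tperm (first r) (first s)).
  by rewrite col_stabE label_stab_tperm // !box_at_col.
have /ffunP/(_ x) := sact_col_antisym T same_col.
rewrite odd_tperm ne scaleN1r ffunE [in RHS]ffunE (_ : [ffun i => _] = x).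
  by move/esym/eqP; rewrite eqNr => /eqP.
by apply/ffunP => i; rewrite ffunE; case: tpermP => [->|->|].
Qed.

End YoungSymmetriser.

(** * The centre of the group algebra *)

Section YoungCentral.
Variables (R : realType) (n : nat).
Local Notation C := R[i].
Local Notation galg := (galg R n).
Implicit Types (la mu : seq nat) (p q s g h : 'S_n).

Definition young_central la : galg :=
  [ffun s => \sum_g young_sym R n la (s ^ g)%g].

Lemma young_central_class la : class_fun (young_central la).
Proof.
move=> s h; rewrite !ffunE [RHS](reindex_inj (mulgI h)).
by apply: eq_bigr => g _; rewrite conjgM.
Qed.

Lemma young_centralE la s : young_central la s =
  \sum_(p | row_stab la p) \sum_(q | col_stab la q) \sum_g
    ((-1) ^+ odd_perm q * (s ^ g == q * p)%g%:R : C).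
Proof.
rewrite ffunE; under eq_bigr => g _ do rewrite ffunE.
by rewrite exchange_big; apply: eq_bigr => p _; rewrite exchange_big.
Qed.

Lemma young_centralV la s : young_central la s^-1%g = young_central la s.
Proof.
rewrite !young_centralE (reindex_inj invg_inj).
apply: eq_big => [p|p _]; first by rewrite !row_stabE label_stabV.
rewrite (reindex_inj invg_inj).
apply: eq_big => [q|q _]; first by rewrite !col_stabE label_stabV.
rewrite (reindex_inj (mulIg p^-1)%g); apply: eq_bigr => g _ /=.
rewrite odd_permV -invMg conjVg (inj_eq invg_inj) conjgM.
by rewrite -(inj_eq (conjg_inj p)) conjgKV [in X in _ == X]conjgE mulgA mulKg.
Qed.

Lemma young_central_conj la s : (young_central la s : C)^* = young_central la s.
Proof.
rewrite young_centralE rmorph_sum; apply: eq_bigr => p _.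
rewrite rmorph_sum; apply: eq_bigr => q _; rewrite rmorph_sum.
apply: eq_bigr => g _.
by rewrite rmorphM /= rmorph_sign rmorph_nat.
Qed.

Lemma young_central1 la : young_central la 1%g = n`!%:R.
Proof.
rewrite ffunE (eq_bigr (fun=> 1)) ?sumr_const ?card_Sn // => g _.
rewrite conj1g ffunE (bigD1 1%g) ?row_stabE ?label_stab1 //=.
rewrite (bigD1 1%g) ?col_stabE ?label_stab1 //=.
rewrite mulg1 eqxx odd_perm1 mulr1 big1 => [|q /andP[_ q1]]; last first.
  by rewrite mulg1 eq_sym (negPf q1) mulr0.
rewrite big1 ?addr0 // => p /andP[rp p1]; apply: big1 => q cq.
case: eqP => [/esym/eqP|]; last by rewrite mulr0.
rewrite mulg_eq1 => /eqP qE; case/eqP: p1; apply: (row_col_stab_eq1 rp).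
by rewrite col_stabE -label_stabV -qE.
Qed.

Section Action.
Variable X : finType.
Implicit Types T : tpow R X n.

Lemma galgact_young_central la T : galgact (young_central la) T =
  \sum_g sact g^-1 (galgact (young_sym R n la) (sact g T)).
Proof.
rewrite /galgact; under eq_bigr => s _ do rewrite ffunE scaler_suml.
rewrite exchange_big; apply: eq_bigr => g _ /=; rewrite linear_sum.
rewrite (reindex_inj (conjg_inj g^-1%g)); apply: eq_bigr => s _ /=.
by rewrite conjgKV linearZ /= !sactM conjgE invgK mulgA.
Qed.

Lemma young_central_sym0 la mu T : is_part n la -> is_part n mu -> la != mu ->
  galgact (young_central la) (galgact (young_sym R n mu) T) = 0.
Proof.
move=> pla pmu ne; have [dom|ndom] := pselect (dominates la mu); last first.
  rewrite galgact_young_central big1 // => g _.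
  by rewrite !galgact_young_sym col_antisym_row_sym0 // !linear0.
rewrite class_fun_galgactC; last exact: young_central_class.
rewrite galgact_young_central linear_sum big1 // => g _.
rewrite /= !galgact_young_sym col_antisym_row_sym0 ?linear0 // => mod.
have [/and3P[_ la0 _] /and3P[_ mu0 _]] := (pla, pmu).
by case/eqP: ne; exact: dominates_anti.
Qed.

Lemma young_central_mul0 la mu T : is_part n la -> is_part n mu -> la != mu ->
  galgact (young_central la) (galgact (young_central mu) T) = 0.
Proof.
move=> pla pmu ne; rewrite [galgact _ T]galgact_young_central linear_sum.
rewrite big1 // => g _ /=.
rewrite class_fun_equivariant ?young_central_sym0 ?linear0 //.
exact: young_central_class.
Qed.

Lemma dot_young_central la T U :
  '[galgact (young_central la) T, U] = '[T, galgact (young_central la) U].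
Proof.
by apply: dot_galgact => s; rewrite young_centralV young_central_conj.
Qed.

End Action.

Lemma young_central_sqr_neq0 la (e := basis_vec R (@perm_word n 1)) :
  galgact (young_central la) (galgact (young_central la) e) != 0.
Proof.
set z := young_central la; apply/eqP => zze0.
have : '[galgact z e] == 0.
  by rewrite dot_young_central zze0 linear0r.
rewrite dnorm_eq0 => /eqP/ffunP/(_ (perm_word 1)).
rewrite galgact_perm_word invg1 young_central1 ffunE => /eqP.
by apply/negP; exact: nfact0.
Qed.

(* The elements [young_central la] annihilate each other but not themselves. *)
Lemma young_central_free (L : seq (seq nat)) :
  uniq L -> (forall la, la \in L -> is_part n la) ->
  free [seq young_central la | la <- L].
Proof.
move=> uL partL; suff: free (map_tuple young_central (in_tuple L)) by [].
apply/freeP => c c0 k; pose l i := nth [::] L i.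
pose e := basis_vec R (@perm_word n 1).
have part_l (i : 'I_(size L)) : is_part n (l i) by rewrite partL ?mem_nth.
have {}c0 : \sum_(i < size L) c i *: young_central (l i) = 0.
  by rewrite -[RHS]c0; apply: eq_bigr => i _; congr (_ *: _);
    exact/esym/nth_map.
have := congr1 (fun a => galgact (young_central (l k)) (galgact a e)) c0.
rewrite linear0l linear0 linear_sumlz linear_sumr (bigD1 k) //= big1 => [|i ik].
  rewrite [LHS]addr0 linearZl_LR linearZ => /eqP.
  by rewrite scaler_eq0 (negPf (young_central_sqr_neq0 _)) orbF => /eqP.
rewrite linearZl_LR linearZ /= young_central_mul0 ?scaler0 //.
by rewrite nth_uniq // eq_sym.
Qed.

Definition cycle_types : seq (seq nat) := undup [seq cycle_type p | p : 'S_n].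

Lemma mem_cycle_types p : cycle_type p \in cycle_types.
Proof. by rewrite mem_undup map_f // mem_enum. Qed.

Lemma cycle_types_uniq : uniq cycle_types.
Proof. exact: undup_uniq. Qed.

Lemma cycle_types_part la : la \in cycle_types -> is_part n la.
Proof.
rewrite mem_undup => /mapP[p _ ->].
by have := cycle_type_is_part p; rewrite card_ord.
Qed.

Definition cycle_class la : galg := [ffun s => (cycle_type s == la)%:R : C].

Lemma class_fun_span (a : galg) :
  class_fun a -> a \in <<[seq cycle_class la | la <- cycle_types]>>%VS.
Proof.
move=> a_class.
pose val la : C := if [pick s | cycle_type s == la] is Some s then a s else 0.
have -> : a = \sum_(la <- cycle_types) val la *: cycle_class la.
  apply/ffunP => s; rewrite sum_ffunE.
  rewrite (bigD1_seq _ (mem_cycle_types s) cycle_types_uniq) /=.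
  rewrite big1 ?addr0 => [|la ne]; last first.
    by rewrite !ffunE eq_sym (negPf ne) [_ *: _]mulr0.
  rewrite !ffunE eqxx [_ *: _]mulr1 /val.
  case: pickP => [s' /eqP/esym/cycle_type_conj[g ->]|/(_ s)].
    by rewrite a_class.
  by rewrite eqxx.
rewrite big_seq; apply: memv_suml => la laL; apply/memvZ/memv_span.
exact: map_f.
Qed.

(* There are as many independent elements [young_central la] as conjugacy
   classes. *)
Lemma young_central_span (a : galg) :
  class_fun a -> a \in <<[seq young_central la | la <- cycle_types]>>%VS.
Proof.
set Y := [seq young_central la | la <- cycle_types].
pose K := [seq cycle_class la | la <- cycle_types].
have YK : (<<Y>> <= <<K>>)%VS.
  apply/span_subvP => _ /mapP[la _ ->].
  by apply: class_fun_span; exact: young_central_class.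
suff /eqP -> : <<Y>>%VS == <<K>>%VS by exact: class_fun_span.
rewrite eqEdim YK (leq_trans (dim_span _)) //.
rewrite size_map -(size_map young_central).
by rewrite (eqP (young_central_free cycle_types_uniq cycle_types_part)).
Qed.

End YoungCentral.

(** * Isotypic projections *)

Section CentralIdempotents.
Variables (R : realType) (n : nat).
Local Notation C := R[i].
Local Notation galg := (galg R n).
Local Notation types := (cycle_types n).
Implicit Types (la mu : seq nat) (p q s g h : 'S_n).

Lemma basis_vec1_class : class_fun (basis_vec R (1%g : 'S_n)).
Proof. by move=> s g; rewrite !ffunE conjg_eq1. Qed.

Lemma young_central_types_free : free [seq young_central R n la | la <- types].
Proof.
exact: young_central_free (@cycle_types_uniq n) (@cycle_types_part n).
Qed.

Definition young_central_coef : galg -> C :=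
  s2val (free_span young_central_types_free
    (young_central_span basis_vec1_class)).

Definition central_idem la : galg :=
  young_central_coef (young_central R n la) *: young_central R n la.

Lemma sum_central_idem : \sum_(la <- types) central_idem la = basis_vec R 1%g.
Proof.
rewrite /central_idem /young_central_coef; case: free_span => c /= -> _.
by rewrite big_map.
Qed.

Lemma central_idem_class la : class_fun (central_idem la).
Proof. by move=> s g; rewrite [LHS]ffunE [RHS]ffunE young_central_class. Qed.

Lemma young_central_coef_conj la : la \in types ->
  (young_central_coef (young_central R n la))^* =
  young_central_coef (young_central R n la).
Proof.
move=> laL; rewrite /young_central_coef; case: free_span => c /= oneE c_uniq.
apply: (c_uniq (fun a => (c a)^*)); last exact: map_f.
apply/ffunP => s; transitivity ((basis_vec R (1%g : 'S_n) s : C)^*).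
  by rewrite ffunE rmorph_nat.
rewrite oneE !sum_ffunE rmorph_sum !big_map; apply: eq_bigr => mu _ /=.
rewrite [RHS]ffunE [in LHS]ffunE [in LHS]/GRing.scale.
by rewrite rmorphM /= young_central_conj.
Qed.

Lemma central_idem_adj la s : la \in types ->
  (central_idem la s^-1%g : C) = (central_idem la s : C)^*.
Proof.
move=> laL; rewrite [LHS]ffunE [in RHS]ffunE [in RHS]/GRing.scale rmorphM /=.
by rewrite young_central_coef_conj // young_central_conj young_centralV.
Qed.

Section Action.
Variable X : finType.
Local Notation W := (tpow R X n).
Implicit Types (T U : W).

Definition isotypic_part la T : W := galgact (central_idem la) T.

HB.instance Definition _ la := GRing.Linear.copy (isotypic_part la)
  (galgact (central_idem la)).

Lemma isotypic_partE la T : isotypic_part la T =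
  young_central_coef (young_central R n la) *: galgact (young_central R n la) T.
Proof. by rewrite /isotypic_part linearZl_LR. Qed.

Lemma sum_isotypic_part T : \sum_(la <- types) isotypic_part la T = T.
Proof.
by rewrite -linear_sumlz sum_central_idem /= galgact_basis_vec sact1.
Qed.

Lemma isotypic_part_equivariant la : sequiv (isotypic_part la).
Proof. exact/class_fun_equivariant/central_idem_class. Qed.

Lemma isotypic_part_glact la (M : 'M[C]_#|X|) T :
  isotypic_part la (glact M T) = glact M (isotypic_part la T).
Proof. exact: galgact_glact. Qed.

Lemma isotypic_part_ortho la mu T : la \in types -> mu \in types -> la != mu ->
  isotypic_part la (isotypic_part mu T) = 0.
Proof.
move=> laL muL ne; rewrite !isotypic_partE linearZ /=.
by rewrite young_central_mul0 ?scaler0 ?cycle_types_part.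
Qed.

Lemma isotypic_part_idem la T : la \in types ->
  isotypic_part la (isotypic_part la T) = isotypic_part la T.
Proof.
move=> laL.
rewrite -[RHS]sum_isotypic_part (bigD1_seq la) ?cycle_types_uniq //=.
by rewrite big1_seq ?addr0 // => mu /andP[ne muL]; exact: isotypic_part_ortho.
Qed.

Lemma isotypic_part_proj la : la \in types ->
  orth_proj (@dot R _) (isotypic_part la).
Proof.
move=> laL; split=> [T|T U]; first exact: isotypic_part_idem.
by apply: dot_galgact => s; exact: central_idem_adj.
Qed.

Lemma isotypic_part_long0 la T :
  is_part n la -> (#|X| < size la)%N -> isotypic_part la T = 0.
Proof.
move=> pla long; rewrite isotypic_partE galgact_young_central.
rewrite big1 ?scaler0 // => g _.
by rewrite galgact_young_sym col_antisym_long0 // !linear0.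
Qed.

Lemma galgact_specht_hom la (f : 'Hom(galg, W)) (a b : galg) :
  specht_hom la f -> specht la b -> galgact a (f b) = f (galg_mul a b).
Proof.
move=> f_hom sb; rewrite galg_mulE linear_sum; apply: eq_bigr => p _.
by rewrite linearZ /= f_hom.
Qed.

Lemma central_idem_specht0 la mu a : la \in types -> mu \in types -> la != mu ->
  specht mu a -> galg_mul (central_idem la) a = 0.
Proof.
move=> laL muL ne [b ->]; apply: galgact_inj => T.
rewrite linear0l !galgact_mul.
rewrite class_fun_galgactC ?linearZl_LR; last exact: central_idem_class.
by rewrite /= young_central_sym0 ?scaler0 ?linear0 ?cycle_types_part.
Qed.

Lemma isotypic_part_id la T : la \in types -> isotypic la T ->
  isotypic_part la T = T.
Proof.
move=> laL [m [f [a [fa ->]]]]; rewrite linear_sum; apply: eq_bigr => i _.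
have [f_hom sa] := fa i.
rewrite -[RHS]sum_isotypic_part (bigD1_seq la) ?cycle_types_uniq //=.
rewrite big1_seq ?addr0 // => mu /andP[ne muL].
by rewrite /isotypic_part (galgact_specht_hom _ f_hom) //
  (central_idem_specht0 muL laL) ?linear0.
Qed.

Lemma isotypic_isotypic_part la T : isotypic la (isotypic_part la T).
Proof.
rewrite isotypic_partE galgact_young_central; apply: isotypicZ.
apply: (big_ind (@isotypic R n X la)) => [|U V|g _]; first exact: isotypic0.
  exact: isotypicD.
exists 1%N, (fun=> linfun (applyr (@galgact R n X) (sact g T))).
exists (fun=> galg_act g^-1%g (young_sym R n la)).
split=> [_|]; last by rewrite big_ord1 lfunE /= galgact_galg_act.
split=> [p a _|]; first by rewrite !lfunE /= galgact_galg_act.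
exists (basis_vec R g^-1%g); apply: galgact_inj => U.
by rewrite galgact_mul galgact_basis_vec galgact_galg_act.
Qed.

Lemma isoprojE la : la \in types ->
  isoproj R n X la = linfun (isotypic_part la).
Proof.
move=> laL; apply: isoproj_uniq (isoprojP _ _ _ _) _; split.
- by move=> p T; rewrite !lfunE /= isotypic_part_equivariant.
- by move=> M T _; rewrite !lfunE /= isotypic_part_glact.
- by apply/lfunP => T; rewrite comp_lfunE !lfunE /= isotypic_part_idem.
move=> T; split=> [/memv_imgP[U _ ->]|isoT].
  by rewrite lfunE; exact: isotypic_isotypic_part.
rewrite -(isotypic_part_id laL isoT) -[isotypic_part _ _]lfunE.
by rewrite memv_img ?memvf.
Qed.

End Action.
End CentralIdempotents.

(** * Dimension of the isotypic components *)

Section JointType.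
Variables (n : nat) (A X : finType).
Implicit Types (f : {ffun 'I_n -> A}) (x : {ffun 'I_n -> X}).

Definition joint_type f x : {ffun A * X -> 'I_n.+1} :=
  [ffun ab => inord #|[set i | (f i, x i) == ab]|].

Lemma joint_type_perm f x x' : joint_type f x = joint_type f x' ->
  exists p : 'S_n, (forall i, f (p i) = f i) /\ (forall i, x (p i) = x' i).
Proof.
move=> /ffunP same_type.
have count_pairs (u : 'I_n -> A * X) ab :
    count_mem ab [tuple u i | i < n] = #|[set i | u i == ab]|.
  rewrite -sum1_count big_tuple -sum1_card.
  by apply: eq_bigl => i; rewrite tnth_mktuple inE.
have /tuple_permP[p pE] :
    perm_eq [tuple (f i, x' i) | i < n] [tuple (f i, x i) | i < n].
  apply/allP => ab _; apply/eqP; rewrite !count_pairs.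
  have := congr1 val (same_type ab); rewrite !ffunE /= !inordK // ltnS.
    by rewrite -[leqRHS]card_ord max_card.
  by rewrite -[leqRHS]card_ord max_card.
exists p; suff pairsE i : (f i, x' i) = (f (p i), x (p i)).
  by split=> i; case: (pairsE i).
have := congr1 (fun s => nth (f i, x i) s i) pE.
by rewrite !nth_mktuple tnth_mktuple.
Qed.

Variable R : realType.

Definition joint_class f (c : {ffun A * X -> 'I_n.+1}) : tpow R X n :=
  [ffun x => (joint_type f x == c)%:R : R[i]].

Lemma word_invariant_span f (T : tpow R X n) :
  (forall p : 'S_n, (forall i, f (p i) = f i) -> sact p T = T) ->
  T \in <<[seq joint_class f c | c : {ffun A * X -> 'I_n.+1}]>>%VS.
Proof.
move=> T_inv; pose val c : R[i] :=
  if [pick x | joint_type f x == c] is Some x then T x else 0.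
have -> : T = \sum_c val c *: joint_class f c.
  apply/ffunP => x; rewrite sum_ffunE (bigD1 (joint_type f x)) //= big1.
    rewrite addr0 !ffunE eqxx [_ *: _]mulr1 /val.
    case: pickP => [x' /eqP/joint_type_perm[p [fp xp]]|/(_ x)];
      last by rewrite eqxx.
    rewrite -[in RHS](T_inv p fp) ffunE; congr (T _).
    by apply/ffunP => i; rewrite ffunE xp.
  by move=> c ne; rewrite !ffunE eq_sym (negPf ne) [_ *: _]mulr0.
by apply: memv_suml => c _; apply/memvZ/memv_span/map_f; rewrite mem_enum.
Qed.

End JointType.

Section ContentWords.
Variables (n : nat) (la : seq nat).

Definition content_words : {set {ffun 'I_n -> 'I_(size la)}} :=
  [set f : {ffun 'I_n -> 'I_(size la)} |
    [forall k : 'I_(size la), #|[set i | f i == k]| == nth 0%N la k]].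

Hypothesis sum_la : sumn la = n.

Lemma row_lt (i : 'I_n) : (reshape_index la i < size la)%N.
Proof. by apply: reshape_indexP; rewrite sum_la. Qed.

Definition row_word (g : 'S_n) : {ffun 'I_n -> 'I_(size la)} :=
  [ffun i => Ordinal (row_lt (g i))].

Lemma row_word_content g : row_word g \in content_words.
Proof.
rewrite inE; apply/forallP => k; rewrite -(card_row sum_la).
rewrite -[X in _ == X](card_preimset _ (@perm_inj _ g)); apply/eqP/eq_card => i.
by rewrite !inE ffunE -val_eqE.
Qed.

Variables (R : realType) (X : finType).

Lemma young_sym_row_invariant (g p : 'S_n) (T : tpow R X n) :
  (forall i, row_word g (p i) = row_word g i) ->
  sact p (sact g^-1 (galgact (young_sym R n la) T)) =
  sact g^-1 (galgact (young_sym R n la) T).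
Proof.
move=> same_row; rewrite galgact_young_sym sactM.
have -> : (g^-1 * p = (g^-1 * p * g) * g^-1)%g by rewrite mulgK.
rewrite -sactM; congr (sact _ _); apply: sact_row_sym; apply/forallP => i.
have /(congr1 val) /= := same_row ((g^-1)%g i).
by rewrite !ffunE !permM /= => ->; rewrite permKV.
Qed.

Definition isotypic_spanning : seq (tpow R X n) :=
  [seq joint_class R f c | f <- enum content_words,
                           c <- enum {: {ffun 'I_(size la) * X -> 'I_n.+1}}].

Lemma size_isotypic_spanning :
  size isotypic_spanning = (#|content_words| * n.+1 ^ (size la * #|X|))%N.
Proof. by rewrite size_allpairs -!cardE card_ffun card_prod !card_ord. Qed.

Lemma isotypic_part_span T : isotypic_part la T \in <<isotypic_spanning>>%VS.
Proof.
rewrite isotypic_partE memvZ // galgact_young_central memv_suml // => g _.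
have := word_invariant_span (fun p => @young_sym_row_invariant g p (sact g T)).
apply/subvP/sub_span => _ /mapP[c _ ->].
by apply: allpairs_f; rewrite mem_enum // row_word_content.
Qed.

End ContentWords.

Lemma sum_isotypic_diag_le (R : realType) (X : finType) n la :
  la \in cycle_types n ->
  \sum_(x : {ffun 'I_n -> X}) (isotypic_part la (basis_vec R x) x : R[i]) <=
  (#|content_words n la| * n.+1 ^ (size la * #|X|))%:R.
Proof.
move=> laL; have /and3P[_ _ /eqP sum_la] := cycle_types_part laL.
rewrite -(size_isotypic_spanning n la R X); apply: trace_idem_le => T.
  exact: isotypic_part_idem.
exact: isotypic_part_span.
Qed.

(** * Typical words *)

Section Logarithms.
Variable R : realType.
Implicit Types x : R.

Lemma ln2_gt0 : 0 < ln 2 :> R.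
Proof. by rewrite ln_gt0 // ltr1n. Qed.

Lemma log2_ln x : log2 x * ln 2 = ln x.
Proof. by rewrite /log2 divfK // gt_eqF ?ln2_gt0. Qed.

Lemma expR_le_quad x : x <= 2^-1 -> expR x <= 1 + x + 2 * x ^+ 2.
Proof.
move=> x_le; have p1 : 0 < 1 - x by lra.
rewrite -[x]opprK expRN -[leRHS]divr1 ler_pdivlMr ?ltr01 // mulr1.
apply: (@le_trans _ _ (1 - x)^-1).
  by rewrite lef_pV2 ?posrE ?expR_gt0 // expR_ge1Dx.
rewrite opprK -[leLHS]mul1r ler_pdivrMr //.
have -> : (1 + x + 2 * x ^+ 2) * (1 - x) = 1 + x ^+ 2 * (1 - 2 * x) by ring.
by rewrite lerDl mulr_ge0 ?sqr_ge0 //; lra.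
Qed.

Lemma poly_exp_small (a eta : R) (k : nat) : 0 < a -> 0 < eta ->
  exists N : nat, forall n, (N <= n)%N ->
    n.+1%:R ^+ k * expR (- (n%:R * a)) < eta.
Proof.
move=> a0 eta0; pose K := 2 ^+ k * (k.+1)`!%:R / a ^+ k.+1.
have f0 : 0 < (k.+1)`!%:R :> R by rewrite ltr0n fact_gt0.
have K0 : 0 < K by rewrite divr_gt0 ?mulr_gt0 ?exprn_gt0.
exists (Num.bound (K / eta)).+1 => n ltNn.
have n0 : 0 < n%:R :> R by rewrite ltr0n (leq_trans _ ltNn).
have Kn : K / n%:R < eta.
  rewrite ltr_pdivrMr // mulrC -ltr_pdivrMr //.
  by rewrite (lt_trans (archi_boundP _)) ?ltr_nat // ltW // divr_gt0.
apply: le_lt_trans Kn; rewrite expRN ler_pdivrMr ?expR_gt0 //.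
have exp_ge : (n%:R * a) ^+ k.+1 / (k.+1)`!%:R <= expR (n%:R * a).
  by apply: le_trans (expR_ge1Dxn k _); rewrite ?lerDr // mulr_ge0 // ltW.
apply: le_trans (ler_wpM2l (ltW (divr_gt0 K0 n0)) exp_ge).
have -> : K / n%:R * ((n%:R * a) ^+ k.+1 / (k.+1)`!%:R) = (2 * n%:R) ^+ k.
  rewrite /K !exprMn [n%:R ^+ k.+1]exprS.
  by field; rewrite !gt_eqF ?exprn_gt0.
have n1 : 1 <= n%:R :> R by rewrite ler1n (leq_trans _ ltNn).
by apply: lerXn2r; rewrite ?nnegrE ?mulr_ge0 // -natr1; lra.
Qed.

End Logarithms.

Section TypicalWords.
Variables (R : realType) (I : finType) (r : I -> R).
Hypotheses (r_ge0 : forall i, 0 <= r i) (sum_r : \sum_i r i = 1).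

(* The derivative of the moment generating function at [0] is the mean. *)
Lemma exp_moment_lt1 (w : I -> R) : \sum_i r i * w i < 0 ->
  exists2 s, 0 < s & \sum_i r i * expR (s * w i) < 1.
Proof.
set m := \sum_i _ => m_lt0; pose K := 1 + \sum_i `|w i|.
have K0 : 0 < K by rewrite ltr_pwDl // sumr_ge0.
have w_le i : `|w i| <= K.
  by rewrite /K (bigD1 i) //= addrCA lerDl addr_ge0 ?ler01 ?sumr_ge0.
have m_ge : - m <= K.
  rewrite -[K]mul1r -sum_r mulr_suml -sumrN; apply: ler_sum => i _.
  by rewrite -mulrN ler_wpM2l // (le_trans (ler_norm _)) // normrN.
pose s := - m / (4 * K ^+ 2).
have sKK : s * (4 * K ^+ 2) = - m.
  by rewrite divfK // gt_eqF ?mulr_gt0 ?exprn_gt0.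
have s0 : 0 < s by rewrite divr_gt0 ?oppr_gt0 ?mulr_gt0 ?exprn_gt0.
have sK : s * K <= 4^-1.
  by rewrite -[leRHS]mulr1 ler_pdivlMl // -(ler_pM2r K0) mul1r; nra.
exists s => //; have sw_le i : `|s * w i| <= s * K.
  by rewrite normrM gtr0_norm // ler_pM2l.
have quad i :
    r i * expR (s * w i) <= r i + s * (r i * w i) + 2 * (s * K) ^+ 2 * r i.
  have -> : r i + s * (r i * w i) + 2 * (s * K) ^+ 2 * r i =
      r i * (1 + s * w i + 2 * (s * K) ^+ 2) by ring.
  apply: ler_wpM2l => //; apply: le_trans (expR_le_quad _) _.
    by have := le_trans (ler_norm _) (sw_le i); lra.
  rewrite lerD2l ler_pM2l // -[leLHS]real_normK ?num_real //.
  by rewrite ler_pXn2r ?nnegrE ?(le_trans _ (sw_le i)).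
apply: le_lt_trans (ler_sum _ (fun i _ => quad i)) _.
rewrite !big_split /= -!mulr_sumr sum_r -/m.
have -> : 2 * (s * K) ^+ 2 = - (s * m) / 2 by rewrite -mulrN -sKK; field.
have : s * m < 0 by rewrite pmulr_rlt0.
lra.
Qed.

Variables (n : nat) (s c : R).
Hypothesis s_gt0 : 0 < s.
Implicit Types x : {ffun 'I_n -> I}.

(* Either the word is typical and has probability at most [expR (- (n * c))],
   or its exponential moment exceeds [1]. *)
Lemma word_weight_le x (D : R) : 0 <= D <= 1 ->
  (\prod_i r (x i)) * D <=
  \prod_i (r (x i) * expR (s * (ln (r (x i)) + c))) + expR (- (n%:R * c)) * D.
Proof.
move=> /andP[D0 D1].
have w0 : 0 <= \prod_i r (x i) by apply: prodr_ge0.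
have [z|nz] := eqVneq (\prod_i r (x i)) 0.
  rewrite z mul0r addr_ge0 ?mulr_ge0 ?expR_ge0 //.
  by apply: prodr_ge0 => i _; rewrite mulr_ge0 ?expR_ge0.
have r_gt0 i : 0 < r (x i).
  by rewrite lt_def r_ge0 andbT; apply: contra nz => ri0; apply/prodf_eq0;
    exists i.
rewrite big_split /= -expR_sum -mulr_sumr big_split /= sumr_const card_ord.
rewrite -[c *+ n]mulr_natl; set L := \sum_i ln _.
have wE : \prod_i r (x i) = expR L.
  by rewrite expR_sum; apply: eq_bigr => i _; rewrite lnK // posrE.
have [atypical|typical] := leP 0 (L + n%:R * c).
  rewrite -[leLHS]addr0 lerD ?mulr_ge0 ?expR_ge0 // ler_wpM2l //.
  by apply: le_trans D1 _; rewrite -[leLHS]expR0 ler_expR mulr_ge0 // ltW.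
rewrite -[leLHS]add0r lerD ?mulr_ge0 ?expR_ge0 // ler_wpM2r //.
by rewrite wE ler_expR; lra.
Qed.

Lemma typical_weight_le (B : R) (D : {ffun 'I_n -> I} -> R) :
  (forall x, 0 <= D x <= 1) -> \sum_x D x <= B ->
  \sum_(x : {ffun 'I_n -> I}) (\prod_i r (x i)) * D x <=
  (\sum_i r i * expR (s * (ln (r i) + c))) ^+ n + expR (- (n%:R * c)) * B.
Proof.
move=> D01 sumD.
apply: le_trans (ler_sum _ (fun x _ => word_weight_le x (D01 x))) _.
rewrite big_split /= -mulr_sumr; apply: lerD;
  last by rewrite ler_wpM2l ?expR_ge0.
by rewrite -[in leRHS](card_ord n) -prodr_const bigA_distr_bigA.
Qed.

End TypicalWords.

Section ContentCount.
Variables (R : realType) (n : nat) (la : seq nat).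
Hypotheses (n_gt0 : (0 < n)%N) (part_la : is_part n la).

Lemma shannon_part_ln : n%:R * (shannon_part R n la * ln 2) =
  - \sum_(k < size la) (nth 0%N la k)%:R * ln ((nth 0%N la k)%:R / n%:R).
Proof.
rewrite /shannon_part mulNr mulrN mulr_suml mulr_sumr (big_nth 0%N) big_mkord.
congr (- _); apply: eq_bigr => k _.
rewrite -[X in _ * X]mulrA log2_ln mulrA mulrCA divff ?mulr1 //.
by rewrite pnatr_eq0 -lt0n.
Qed.

(* Each of these words has probability [exp (- n H)] in the product of the
   distribution [la / n]. *)
Lemma card_content_words_le :
  #|content_words n la|%:R <= expR (n%:R * (shannon_part R n la * ln 2)).
Proof.
have /and3P[_ la0 /eqP sum_la] := part_la.
pose w (k : 'I_(size la)) : R := (nth 0%N la k)%:R / n%:R.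
have nR : 0 < n%:R :> R by rewrite ltr0n.
have w_gt0 k : 0 < w k.
  by rewrite divr_gt0 // ltr0n lt0n; apply: contraNneq la0 => <-;
    exact: mem_nth.
have sum_w : \sum_k w k = 1.
  rewrite -mulr_suml -natr_sum.
  rewrite -(big_mkord xpredT (nth 0%N la)) -(big_nth 0%N xpredT id) -sumnE.
  by rewrite sum_la divff // gt_eqF.
have sum_words : \sum_(f : {ffun 'I_n -> 'I_(size la)}) \prod_i w (f i) = 1.
  by rewrite -(bigA_distr_bigA (fun=> w)) prodr_const sum_w expr1n.
rewrite shannon_part_ln expRN -[leRHS]mul1r ler_pdivlMr ?expR_gt0 //.
rewrite -sum1_card natr_sum mulr_suml -[leRHS]sum_words.
rewrite [leRHS](bigID (mem (content_words n la))) /= -[leLHS]addr0.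
rewrite lerD //; last first.
  by apply: sumr_ge0 => f _; apply: prodr_ge0 => i _; exact: ltW.
apply: ler_sum => f; rewrite inE => /forallP f_content; rewrite mul1r expR_sum.
rewrite [leRHS](partition_big f xpredT) //= le_eqVlt; apply/orP; left.
apply/eqP/eq_bigr => k _; rewrite (eq_bigr (fun=> w k)) => [|i /eqP -> //].
rewrite prodr_const expRM_natl lnK ?posrE ?w_gt0 //; congr (_ ^+ _).
by rewrite -(eqP (f_content k)); apply: eq_card => i; rewrite inE.
Qed.

End ContentCount.

(** * Unitary invariance *)

Local Open Scope sesquilinear_scope.

Lemma prod_eq_dffun (K : comPzSemiRingType) (I : finType) (J : I -> eqType)
    (x y : {dffun forall i, J i}) : \prod_i (x i == y i)%:R = (x == y)%:R :> K.
Proof.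
have [->|ne] := eqVneq x y; first by rewrite big1 // => i _; rewrite eqxx.
have /existsP[i /negPf xyi] : [exists i, x i != y i].
  by rewrite -negb_forall; apply: contra ne => /forallP xy;
    apply/eqP/ffunP => i; apply/eqP.
by rewrite (bigD1 i) //= xyi mul0r.
Qed.

Section MatrixAction.
Variables (R : realType) (n : nat) (X : finType).
Local Notation C := R[i].
Local Notation W := (tpow R X n).
Implicit Types (M N U : 'M[C]_#|X|) (T : W).

Lemma glactM M N T : glact M (glact N T) = glact (M *m N) T.
Proof.
apply/ffunP => x; rewrite !ffunE.
under eq_bigr => y _ do rewrite ffunE mulr_sumr.
rewrite exchange_big; apply: eq_bigr => z _ /=.
under eq_bigr => y _ do rewrite mulrA -big_split.
rewrite -mulr_suml; congr (_ * _).
rewrite -(bigA_distr_bigA (fun i a =>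
  M (enum_rank (x i)) (enum_rank a) * N (enum_rank a) (enum_rank (z i)))).
by apply: eq_bigr => i _; rewrite mxE sum_enum_rank.
Qed.

Lemma glact1 T : glact 1%:M T = T.
Proof.
apply/ffunP => x; rewrite ffunE -[RHS]dot_basis_vec; apply: eq_bigr => y _.
rewrite ffunE mulrC rmorph_nat eq_sym -(@prod_eq_dffun C _ (fun=> X) x y).
by congr (_ * _); apply: eq_bigr => i _; rewrite mxE (inj_eq enum_rank_inj).
Qed.

Lemma dot_glact M T T' : '[glact M T, T'] = '[T, glact (M ^t*) T'].
Proof.
rewrite /dot; under eq_bigr => x _ do rewrite ffunE mulr_suml.
rewrite exchange_big; apply: eq_bigr => y _ /=.
rewrite ffunE rmorph_sum mulr_sumr.
apply: eq_bigr => x _; rewrite rmorphM rmorph_prod /= mulrCA mulrA.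
congr (_ * _ * _); apply: eq_bigr => i _.
by rewrite !mxE conjCK.
Qed.

Lemma dot_glact_unitary U T T' : U \is unitarymx ->
  '[glact U T, glact U T'] = '[T, T'].
Proof.
by move=> /unitarymxP/mulmx1C UU; rewrite dot_glact glactM UU glact1.
Qed.

End MatrixAction.

Section ColumnProducts.
Variables (R : realType) (n : nat) (X Y : finType).
Local Notation C := R[i].
Implicit Types (V : 'M[C]_(#|X|, #|Y|)) (y : {ffun 'I_n -> Y}).

Definition column_prod V y : tpow R X n :=
  [ffun x : {ffun 'I_n -> X} =>
     \prod_i V (enum_rank (x i)) (enum_rank (y i)) : C].

Lemma glact_column_prod (M : 'M_#|X|) V y :
  glact M (column_prod V y) = column_prod (M *m V) y.
Proof.
apply/ffunP => x; rewrite !ffunE.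
under [LHS]eq_bigr => z _ do rewrite ffunE -big_split.
rewrite -(bigA_distr_bigA (fun i a =>
  M (enum_rank (x i)) (enum_rank a) * V (enum_rank a) (enum_rank (y i)))).
by apply: eq_bigr => i _; rewrite mxE sum_enum_rank.
Qed.

(* This is the trace of [f] against the [n]-th tensor power of [V *m V^t*]. *)
Lemma sum_dot_column_prod (f : {linear tpow R X n -> tpow R X n}) V
    (D : 'rV[C]_#|X|) : V *m V ^t* = diag_mx D ->
  \sum_y '[f (column_prod V y), column_prod V y] =
  \sum_(x : {ffun 'I_n -> X})
    (\prod_i D 0 (enum_rank (x i))) * f (basis_vec R x) x.
Proof.
move=> VV.
have gram (x x' : {ffun 'I_n -> X}) :
    \sum_y column_prod V y x * (column_prod V y x' : C)^* =
    (x == x')%:R * \prod_i D 0 (enum_rank (x i)).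
  under [LHS]eq_bigr => y _ do rewrite !ffunE rmorph_prod -big_split /=.
  rewrite -(bigA_distr_bigA (fun i c => V (enum_rank (x i)) (enum_rank c) *
    (V (enum_rank (x' i)) (enum_rank c))^*)).
  rewrite -(@prod_eq_dffun C _ (fun=> X) x x') -big_split.
  apply: eq_bigr => i _ /=.
  have /matrixP/(_ (enum_rank (x i)) (enum_rank (x' i))) := VV.
  rewrite !mxE (inj_eq enum_rank_inj) sum_enum_rank mulr_natl => <-.
  by apply: eq_bigr => c _; rewrite !mxE.
transitivity (\sum_x \sum_x' \sum_y
    f (basis_vec R x) x' * (column_prod V y x * (column_prod V y x' : C)^*)).
  under [LHS]eq_bigr => y _ do rewrite {1}(basis_vecE (column_prod V y))
    linear_sum linear_sumlz.
  rewrite exchange_big; apply: eq_bigr => x _ /=; rewrite exchange_big.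
  apply: eq_bigr => x' _; apply: eq_bigr => y _ /=.
  by rewrite linearZ [X in X * _]ffunE -[RHS]mulrCA mulrA.
apply: eq_bigr => x _; under [LHS]eq_bigr => x' _ do rewrite -mulr_sumr gram.
rewrite (bigD1 x) //= eqxx mul1r [X in _ + X]big1 => [|x' ne].
  by rewrite addr0 mulrC.
by rewrite eq_sym (negPf ne) mul0r mulr0.
Qed.

End ColumnProducts.

(** * Reduced densities *)

Section HermitianSpectrum.
Variables (R : realType) (m : nat) (rho : 'M[R[i]]_m).
Local Notation C := R[i].

Definition spectral_weight (i : 'I_m) : R := complex.Re (spectral_diag rho 0 i).

Hypothesis rho_herm : rho \is hermsymmx.

Lemma spectral_weightE i : spectral_diag rho 0 i = (spectral_weight i)%:C%C.
Proof.
by rewrite RRe_real // (mxOverP (hermitian_spectral_diag_real rho_herm)).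
Qed.

Lemma spectralmx_diagonalises :
  spectralmx rho *m rho *m invmx (spectralmx rho) = diag_mx (spectral_diag rho).
Proof.
have /orthomx_spectralP rhoE := hermitian_normalmx rho_herm.
rewrite [X in _ *m X *m _]rhoE !mulmxA.
by rewrite mulmxK ?mulmxV ?mul1mx // spectral_unit.
Qed.

Lemma sum_spectral_weight : (\sum_i spectral_weight i)%:C%C = \tr rho.
Proof.
transitivity (\tr (diag_mx (spectral_diag rho))).
  rewrite mxtrace_diag rmorph_sum; apply: eq_bigr => i _.
  by rewrite spectral_weightE.
by rewrite -spectralmx_diagonalises mxtrace_mulC mulKmx // spectral_unit.
Qed.

Lemma vN_entropy_herm :
  vN_entropy rho = - \sum_i spectral_weight i * log2 (spectral_weight i).
Proof.
rewrite /vN_entropy /mxlog2; set L := diag_mx (map_mx _ _).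
have -> : \tr (rho *m (invmx (spectralmx rho) *m L *m spectralmx rho)) =
    \tr (diag_mx (spectral_diag rho) *m L).
  by rewrite -spectralmx_diagonalises !mulmxA mxtrace_mulC !mulmxA.
rewrite /L mulmx_diag mxtrace_diag raddfN /=; congr (- _).
rewrite (_ : \sum_i _ =
  (\sum_i spectral_weight i * log2 (spectral_weight i))%:C%C) //.
by rewrite rmorph_sum; apply: eq_bigr => i _;
  rewrite !mxE spectral_weightE -rmorphM.
Qed.

End HermitianSpectrum.

Section ReducedDensity.
Variables (R : realType) (m p : nat) (V : 'M[R[i]]_(m, p)).
Local Notation C := R[i].

Definition frob_sqr : C := \tr (V *m V ^t*).

Definition reduced_density : 'M[C]_m := frob_sqr^-1 *: (V *m V ^t*).

End ReducedDensity.

Section ReducedDensityTheory.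
Variables (R : realType) (m p : nat) (V : 'M[R[i]]_(m, p)).
Local Notation C := R[i].
Local Notation rho := (reduced_density V).

Lemma gram_diag_ge0 q (W : 'M[C]_(m, q)) i : 0 <= (W *m W ^t*) i i.
Proof. by rewrite mxE; apply: sumr_ge0 => j _; rewrite !mxE mul_conjC_ge0. Qed.

Lemma frob_sqr_ge0 : 0 <= frob_sqr V.
Proof. by apply: sumr_ge0 => i _; exact: gram_diag_ge0. Qed.

Lemma reduced_density_herm : rho \is hermsymmx.
Proof.
apply/is_hermitianmxP; rewrite expr0 scale1r linearZ map_mxZ /=.
by rewrite trmx_mul map_mxM fmorphV /= geC0_conj ?frob_sqr_ge0 // trmxCK.
Qed.

Hypothesis frob_neq0 : frob_sqr V != 0.

Lemma gram_spectral_rotation (W := spectralmx rho *m V) :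
  W *m W ^t* = diag_mx (frob_sqr V *: spectral_diag rho).
Proof.
have -> : W *m W ^t* =
    frob_sqr V *: (spectralmx rho *m rho *m (spectralmx rho) ^t*).
  rewrite /W /reduced_density trmx_mul map_mxM /= -!scalemxAr -!scalemxAl.
  by rewrite scalerA divff // scale1r !mulmxA.
rewrite [RHS]linearZ /= -(spectralmx_diagonalises reduced_density_herm).
by rewrite invmx_unitary // spectral_unitarymx.
Qed.

Lemma spectral_weight_ge0 i : 0 <= spectral_weight rho i.
Proof.
rewrite -ler0c -(spectral_weightE reduced_density_herm).
have frob_gt0 : 0 < frob_sqr V by rewrite lt_def frob_neq0 frob_sqr_ge0.
rewrite -(pmulr_rge0 _ frob_gt0).
have := gram_diag_ge0 (spectralmx rho *m V) i.
by rewrite gram_spectral_rotation !mxE eqxx mulr1n.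
Qed.

Lemma sum_spectral_weight1 : \sum_i spectral_weight rho i = 1.
Proof.
apply: complexI; rewrite (sum_spectral_weight reduced_density_herm).
by rewrite mxtraceZ mulVf.
Qed.

End ReducedDensityTheory.

(** * Weights of the isotypic components *)

Section IsotypicDiagonal.
Variables (R : realType) (X : finType) (n : nat) (la : seq nat).
Local Notation C := R[i].
Implicit Types x : {ffun 'I_n -> X}.

Definition isotypic_diag x : R :=
  complex.Re (isotypic_part la (basis_vec R x) x).

Hypothesis la_type : la \in cycle_types n.

Lemma isotypic_diagE x :
  isotypic_part la (basis_vec R x) x = (isotypic_diag x)%:C%C.
Proof.
have diag_ge0 := orth_proj_diag_ge0 (isotypic_part_proj R X la_type) x.
by rewrite RRe_real // ger0_real.
Qed.

Lemma isotypic_diag01 x : 0 <= isotypic_diag x <= 1.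
Proof.
have := orth_proj_diag_ge0 (isotypic_part_proj R X la_type) x.
have := orth_proj_diag_le1 (isotypic_part_proj R X la_type) x.
by rewrite /= isotypic_diagE ler0c -[1]/(1%:C)%C lecR => -> ->.
Qed.

Lemma sum_isotypic_diag_expR_le : (0 < n)%N -> (size la <= #|X|)%N ->
  \sum_x isotypic_diag x <=
  expR (n%:R * (shannon_part R n la * ln 2)) * n.+1%:R ^+ (#|X| * #|X|).
Proof.
move=> n_gt0 short.
apply: (@le_trans _ _ (#|content_words n la| * n.+1 ^ (size la * #|X|))%:R).
  rewrite -lecR rmorph_sum rmorph_nat.
  apply: le_trans (sum_isotypic_diag_le R X la_type).
  by apply: ler_sum => x _; rewrite isotypic_diagE.
rewrite natrM natrX ler_pM ?exprn_ge0 //.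
  exact: card_content_words_le n_gt0 (cycle_types_part la_type).
by rewrite ler_weXn2l ?ler1n // leq_mul2r short orbT.
Qed.

End IsotypicDiagonal.

Section IsotypicWeight.
Variables (R : realType) (X Y : finType) (V : 'M[R[i]]_(#|X|, #|Y|)).
Local Notation C := R[i].
Local Notation rho := (reduced_density V).

Definition isotypic_weight n la : R := \sum_(x : {ffun 'I_n -> X})
  (\prod_i spectral_weight rho (enum_rank (x i))) * isotypic_diag R la x.

Hypothesis frob_neq0 : frob_sqr V != 0.

Lemma sum_dnorm_isotypic_part n la : la \in cycle_types n ->
  \sum_(y : {ffun 'I_n -> Y})
    '[isotypic_part la (column_prod V y)] =
  frob_sqr V ^+ n * (isotypic_weight n la)%:C%C.
Proof.
move=> laL; pose W := spectralmx rho *m V.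
have rotate (y : {ffun 'I_n -> Y}) :
    '[isotypic_part la (column_prod V y)] =
    '[isotypic_part la (column_prod W y), column_prod W y].
  rewrite -glact_column_prod isotypic_part_glact.
  rewrite (dot_glact_unitary _ _ (spectral_unitarymx _)).
  by apply: dnorm_orth_proj; exact: isotypic_part_proj.
under eq_bigr => y _ do rewrite rotate.
rewrite (sum_dot_column_prod _ (gram_spectral_rotation frob_neq0)).
rewrite rmorph_sum mulr_sumr.
apply: eq_bigr => x _; rewrite isotypic_diagE // rmorphM mulrA; congr (_ * _).
rewrite rmorph_prod; under [LHS]eq_bigr => i _.
  rewrite mxE (spectral_weightE (reduced_density_herm V)).
  over.
by rewrite big_split prodr_const card_ord.
Qed.

Lemma vN_entropy_ln : vN_entropy rho * ln 2 =
  - \sum_x spectral_weight rho (enum_rank x) *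
             ln (spectral_weight rho (enum_rank x)).
Proof.
rewrite vN_entropy_herm ?reduced_density_herm // mulNr mulr_suml sum_enum_rank.
by congr (- _); apply: eq_bigr => x _; rewrite -mulrA log2_ln.
Qed.

Lemma isotypic_weight_le (eps : R) : 0 < eps ->
  exists2 a, 0 < a & forall n la, (0 < n)%N -> la \in cycle_types n ->
    (size la <= #|X|)%N -> shannon_part R n la <= vN_entropy rho - eps ->
    isotypic_weight n la <=
    expR (- (n%:R * a)) + n.+1%:R ^+ (#|X| * #|X|) * expR (- (n%:R * a)).
Proof.
move=> eps0; pose r x := spectral_weight rho (enum_rank x).
pose delta := eps * ln 2 / 2; pose c := vN_entropy rho * ln 2 - delta.
have delta0 : 0 < delta by rewrite divr_gt0 // mulr_gt0 // ln2_gt0.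
have r_ge0 x : 0 <= r x by exact: spectral_weight_ge0.
have sum_r : \sum_x r x = 1.
  by rewrite -(sum_spectral_weight1 frob_neq0) sum_enum_rank.
have mean_lt0 : \sum_x r x * (ln (r x) + c) < 0.
  under eq_bigr => x _ do rewrite mulrDr.
  rewrite big_split /= -mulr_suml sum_r -[X in X + _]opprK -vN_entropy_ln.
  by rewrite /c; lra.
have [s s0] := exp_moment_lt1 r_ge0 sum_r mean_lt0; set q := \sum_x _ => q1.
exists (Num.min (1 - q) delta); first by rewrite lt_min delta0 subr_gt0 q1.
move=> n la n0 laL short low; set a := Num.min _ _.
have := typical_weight_le r_ge0 c s0 (isotypic_diag01 R laL)
  (sum_isotypic_diag_expR_le R laL n0 short).
move=> /le_trans; apply; apply: lerD.
  have q0 : 0 <= q by apply: sumr_ge0 => i _; rewrite mulr_ge0 ?expR_ge0.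
  have : q <= expR (- a).
    by apply: le_trans (expR_ge1Dx _); rewrite -lerBlDl lerNr opprB ge_min lexx.
  by move/(lerXn2r n q0 (expR_ge0 _))/le_trans; apply;
    rewrite -expRM_natl mulrN.
rewrite mulrA -expRD [leRHS]mulrC ler_wpM2r ?exprn_ge0 // ler_expR.
have low2 : shannon_part R n la * ln 2 <= (vN_entropy rho - eps) * ln 2.
  by rewrite ler_wpM2r // ltW // ln2_gt0.
have a_delta : a <= delta by rewrite ge_min lexx orbT.
rewrite -!mulrN -mulrDr ler_wpM2l // /c.
have : eps * ln 2 = 2 * delta by rewrite /delta; field.
by move: low2; rewrite mulrBl; lra.
Qed.

Lemma low_entropy_weight_small (eps eta : R) : 0 < eps -> 0 < eta ->
  exists N, forall n, (N <= n)%N ->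
  \sum_(la <- cycle_types n | shannon_part R n la <= vN_entropy rho - eps)
    \sum_(y : {ffun 'I_n -> Y})
      '[isotypic_part la (column_prod V y)]
  <= frob_sqr V ^+ n * eta%:C%C.
Proof.
move=> eps0 eta0; have [a a0 weight_le] := isotypic_weight_le eps0.
set d := #|X|.
have eta2 : 0 < eta / 2 by rewrite divr_gt0.
have [N1 smallN1] := poly_exp_small d a0 eta2.
have [N2 smallN2] := poly_exp_small (d + d * d) a0 eta2.
exists (maxn 1 (maxn N1 N2)) => n; rewrite !geq_max => /and3P[n0 nN1 nN2].
rewrite (bigID (fun la => size la <= d)%N) /= [X in _ + X]big1_seq ?addr0;
  last first.
  move=> la /andP[/andP[_ long] laL]; apply: big1 => y _.
  by rewrite isotypic_part_long0 ?linear0l ?cycle_types_part // ltnNge.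
rewrite -big_filter; set L := filter _ _.
have LP la : la \in L -> [/\ la \in cycle_types n, (size la <= d)%N &
    shannon_part R n la <= vN_entropy rho - eps].
  by rewrite mem_filter => /andP[/andP[-> ->] ->].
have size_L : (size L)%:R <= n.+1%:R ^+ d :> R.
  rewrite -natrX ler_nat; apply: size_short_parts.
    by rewrite filter_uniq // cycle_types_uniq.
  by move=> la /LP[laL -> _]; rewrite cycle_types_part.
rewrite (eq_big_seq (fun la => frob_sqr V ^+ n * (isotypic_weight n la)%:C%C));
  last first.
  by move=> la /LP[laL _ _]; exact: sum_dnorm_isotypic_part.
rewrite -mulr_sumr ler_wpM2l ?exprn_ge0 ?frob_sqr_ge0 // -rmorph_sum lecR.
pose K := expR (- (n%:R * a)) + n.+1%:R ^+ (d * d) * expR (- (n%:R * a)).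
apply: (@le_trans _ _ (\sum_(la <- L) K)).
  rewrite big_seq [leRHS]big_seq; apply: ler_sum => la /LP[laL short low].
  exact: weight_le.
rewrite big_const_seq count_predT iter_addr_0 -mulr_natl.
have K0 : 0 <= K by rewrite addr_ge0 ?mulr_ge0 ?exprn_ge0 ?expR_ge0.
apply: le_trans (ler_wpM2r K0 size_L) _; rewrite /K mulrDr mulrA -exprD.
by have := smallN1 n nN1; have := smallN2 n nN2; lra.
Qed.

End IsotypicWeight.

(** * Splitting off a set of legs *)

Lemma prod_sum_dffun (K : comPzSemiRingType) (I : finType) (J : I -> finType)
    (F : forall i, J i -> K) :
  \prod_i \sum_(l : J i) F i l =
  \sum_(t : {dffun forall i, J i}) \prod_i F i (t i).
Proof.
pose P i : {ffun J i -> K} := finfun (@F i).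
transitivity (\sum_(t : fprod J) \prod_(i in I) P i (t i)); last first.
  rewrite [RHS](reindex (@dffun_of_fprod I J)) /=;
    last exact/onW_bij/dffun_of_fprod_bij.
  by apply: eq_bigr => t _; apply: eq_bigr => i _; rewrite !ffunE.
rewrite (@big_fprod K 0 1 *%R +%R I J P).
transitivity (\prod_i \sum_(j in tagged_with J i) untag 0 (P i) j).
  by apply: eq_bigr => i _; rewrite -(@big_tag K 0 +%R I J P i);
    apply: eq_bigr => l _; rewrite ffunE.
by rewrite bigA_distr_big_dep.
Qed.

Section TensorMatrix.
Variables (K : comPzSemiRingType) (I : finType) (d : I -> nat).
Local Notation multi_index := {dffun forall i, 'I_(d i)}.
Variable A : forall i, 'M[K]_(d i).

Definition tensor_mx : 'M[K]_#|{: multi_index}| := \matrix_(a, b)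
  \prod_i A i ((enum_val a : multi_index) i) ((enum_val b : multi_index) i).

Lemma tensor_mxE (x y : multi_index) :
  tensor_mx (enum_rank x) (enum_rank y) = \prod_i A i (x i) (y i).
Proof. by rewrite mxE !enum_rankK. Qed.

End TensorMatrix.

Section Glue.
Variables (k : nat) (d : 'I_k -> nat) (S : {set 'I_k}).
Local Notation X := (idxS d S).
Local Notation Y := (idxS d (~: S)).

Lemma glue_in (x : X) (y : Y) (j : {j | j \in S}) : glue x y (val j) = x j.
Proof.
case: j => j jS; rewrite ffunE /=; case: {-}_ / boolP => [jS'|jS'].
  by rewrite (bool_irrelevance jS jS').
by case/negP: (jS').
Qed.

Lemma glue_notin (x : X) (y : Y) (j : {j | j \in ~: S}) :
  glue x y (val j) = y j.
Proof.
case: j => j jS; rewrite ffunE /=; case: {-}_ / boolP => [jS'|jS'].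
  by exfalso; move: jS; rewrite inE jS'.
by rewrite (bool_irrelevance jS (notin_setC jS')).
Qed.

Lemma resS_glue (x : X) (y : Y) : resS S (glue x y) = x.
Proof. by apply/ffunP => j; rewrite ffunE glue_in. Qed.

Lemma resSC_glue (x : X) (y : Y) : resS (~: S) (glue x y) = y.
Proof. by apply/ffunP => j; rewrite ffunE glue_notin. Qed.

Lemma glue_resS (z : idx d) : glue (resS S z) (resS (~: S) z) = z.
Proof.
by apply/ffunP => j; rewrite ffunE; case: {-}_ / boolP => jS; rewrite ffunE.
Qed.

Lemma sum_glue (V : nmodType) (F : idx d -> V) :
  \sum_z F z = \sum_(x : X) \sum_(y : Y) F (glue x y).
Proof.
rewrite (pair_bigA _ (fun x y => F (glue x y))) /=.
rewrite (reindex (fun p : X * Y => glue p.1 p.2)) //.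
exists (fun z => (resS S z, resS (~: S) z)) => [[x y] _|z _] /=.
  by rewrite resS_glue resSC_glue.
exact: glue_resS.
Qed.

Lemma prod_glue (K : comPzSemiRingType)
    (F : forall j, 'I_(d j) -> 'I_(d j) -> K) (x x' : X) (y y' : Y) :
  \prod_j F j (glue x y j) (glue x' y' j) =
  (\prod_(j : {j | j \in S}) F (val j) (x j) (x' j)) *
  \prod_(j : {j | j \in ~: S}) F (val j) (y j) (y' j).
Proof.
rewrite (bigID (mem S)) /=; congr (_ * _).
  by rewrite big_sub; apply: eq_bigr => j _; rewrite !glue_in.
rewrite (eq_bigl (mem (~: S))) => [|j]; last by rewrite !inE.
by rewrite big_sub; apply: eq_bigr => j _; rewrite !glue_notin.
Qed.

Variable n : nat.

Definition glue_words (x : {ffun 'I_n -> X}) (y : {ffun 'I_n -> Y}) :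
    {ffun 'I_n -> idx d} :=
  [ffun i => glue (x i) (y i)].

Lemma glue_words_resS (z : {ffun 'I_n -> idx d}) :
  glue_words [ffun i => resS S (z i)] [ffun i => resS (~: S) (z i)] = z.
Proof. by apply/ffunP => i; rewrite !ffunE glue_resS. Qed.

Lemma sum_glue_words (V : nmodType) (F : {ffun 'I_n -> idx d} -> V) :
  \sum_z F z = \sum_x \sum_y F (glue_words x y).
Proof.
rewrite (pair_bigA _ (fun x y => F (glue_words x y))) /=.
rewrite (reindex (fun p : {ffun 'I_n -> X} * {ffun 'I_n -> Y} =>
  glue_words p.1 p.2)) //.
exists (fun z : {ffun 'I_n -> idx d} =>
    ([ffun i => resS S (z i)], [ffun i => resS (~: S) (z i)])).
  move=> [x y] _ /=.
  by congr pair; apply/ffunP => i; rewrite !ffunE ?resS_glue ?resSC_glue.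
by move=> z _; exact: glue_words_resS.
Qed.

End Glue.

Section Slices.
Variables (R : realType) (k : nat) (d : 'I_k -> nat) (S : {set 'I_k}) (n : nat).
Local Notation C := R[i].
Local Notation X := (idxS d S).
Local Notation Y := (idxS d (~: S)).
Implicit Types (T U : tpow R (idx d) n) (y : {ffun 'I_n -> Y}).

Definition slice y T : tpow R X n := [ffun x => T (glue_words x y)].

Fact slice_linear y : linear (slice y).
Proof. by move=> c T U; apply/ffunP => x; rewrite !ffunE. Qed.
HB.instance Definition _ y :=
  GRing.isLinear.Build C _ _ _ (slice y) (slice_linear y).

Lemma slice_inj T U : (forall y, slice y T = slice y U) -> T = U.
Proof.
move=> TU; apply/ffunP => z; rewrite -(glue_words_resS S z).
set x := finfun _; set y := finfun _.
by have /ffunP/(_ x) := TU y; rewrite !ffunE.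
Qed.

Lemma dot_slice T U : '[T, U] = \sum_y '[slice y T, slice y U].
Proof.
rewrite /dot (sum_glue_words S) exchange_big; apply: eq_bigr => y _ /=.
by apply: eq_bigr => x _; rewrite !ffunE.
Qed.

Lemma slice_sact p T y :
  slice y (sact p T) = sact p (slice [ffun i => y (p i)] T).
Proof.
apply/ffunP => x; rewrite !ffunE; congr (T _); apply/ffunP => i.
by rewrite !ffunE.
Qed.

Lemma slice_ext_id P T y : slice y (ext_id P T) = P (slice y T).
Proof.
apply/ffunP => x; rewrite !ffunE; congr (P _ _); last first.
  by apply/ffunP => i; rewrite !ffunE resS_glue.
apply/ffunP => x'; rewrite !ffunE; congr (T _); apply/ffunP => i.
by rewrite !ffunE resSC_glue.
Qed.

Lemma slice_glact_tensor_mx (A : forall j, 'M[C]_(d j)) T y :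
  slice y (glact (tensor_mx A) T) = \sum_(y' : {ffun 'I_n -> Y})
    (\prod_i tensor_mx (fun j : {j | j \in ~: S} => A (val j))
       (enum_rank (y i)) (enum_rank (y' i))) *:
    glact (tensor_mx (fun j : {j | j \in S} => A (val j))) (slice y' T).
Proof.
apply/ffunP => x; rewrite !ffunE (sum_glue_words S) exchange_big sum_ffunE.
apply: eq_bigr => y' _; rewrite !ffunE [RHS]mulr_sumr.
apply: eq_bigr => x' _ /=.
rewrite ffunE mulrA; congr (_ * _); rewrite mulrC -big_split.
apply: eq_bigr => i _; rewrite !ffunE !tensor_mxE.
exact: (prod_glue (fun j => A j)).
Qed.

Definition side_part la T : tpow R (idx d) n :=
  ext_id (linfun (@isotypic_part R n X la)) T.

Lemma slice_side_part la T y :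
  slice y (side_part la T) = isotypic_part la (slice y T).
Proof. by rewrite slice_ext_id lfunE. Qed.

Fact side_part_linear la : linear (side_part la).
Proof.
move=> c T U; apply: slice_inj => y.
by rewrite [RHS]linearP /= !slice_side_part linearP /= linearP.
Qed.
HB.instance Definition _ la :=
  GRing.isLinear.Build C _ _ _ (side_part la) (side_part_linear la).

Lemma sum_side_part T : \sum_(la <- cycle_types n) side_part la T = T.
Proof.
apply: slice_inj => y; rewrite linear_sum -[RHS]sum_isotypic_part.
by apply: eq_bigr => la _; rewrite /= slice_side_part.
Qed.

Lemma side_part_ortho la mu T : la \in cycle_types n -> mu \in cycle_types n ->
  la != mu -> side_part la (side_part mu T) = 0.
Proof.
move=> laL muL ne; apply: slice_inj => y.
by rewrite !slice_side_part isotypic_part_ortho // linear0.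
Qed.

Lemma side_part_proj la : la \in cycle_types n ->
  orth_proj (@dot R _) (side_part la).
Proof.
move=> laL; split=> [T|T U].
  by apply: slice_inj => y; rewrite !slice_side_part isotypic_part_idem.
have [_ adj] := isotypic_part_proj R X laL.
by rewrite /= !dot_slice; apply: eq_bigr => y _; rewrite !slice_side_part;
  exact: adj.
Qed.

Lemma side_part_equivariant la : sequiv (side_part la).
Proof.
move=> p T; apply: slice_inj => y.
by rewrite !(slice_side_part, slice_sact) isotypic_part_equivariant.
Qed.

Lemma side_part_glact_tensor_mx la (A : forall j, 'M[C]_(d j)) T :
  side_part la (glact (tensor_mx A) T) = glact (tensor_mx A) (side_part la T).
Proof.
apply: slice_inj => y; rewrite slice_side_part !slice_glact_tensor_mx.
rewrite linear_sum; apply: eq_bigr => y' _.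
by rewrite linearZ /= isotypic_part_glact slice_side_part.
Qed.

Section SelectedParts.
Variable good : pred (seq nat).

Definition selected_part T : tpow R (idx d) n :=
  \sum_(la <- [seq la <- cycle_types n | good la]) side_part la T.

Fact selected_part_linear : linear selected_part.
Proof.
move=> c T U; rewrite /selected_part scaler_sumr -big_split.
by apply: eq_bigr => la _; rewrite linearP.
Qed.
HB.instance Definition _ :=
  GRing.isLinear.Build C _ _ _ selected_part selected_part_linear.

End SelectedParts.

Lemma selected_part_proj good : orth_proj (@dot R _) (selected_part good).
Proof.
apply: orth_proj_sum => [|la|la mu T].
- by rewrite filter_uniq // cycle_types_uniq.
- by rewrite mem_filter => /andP[_]; exact: side_part_proj.
by rewrite !mem_filter => /andP[_ laL] /andP[_ muL]; exact: side_part_ortho.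
Qed.

Lemma dnorm_selected_part_defect good T :
  '[T - selected_part good T] =
  \sum_(la <- cycle_types n | ~~ good la) '[side_part la T].
Proof.
have -> : T - selected_part good T = selected_part (predC good) T.
  rewrite -{1}(sum_side_part T) (bigID good) /= /selected_part !big_filter.
  by rewrite addrAC subrr add0r.
rewrite -[RHS]big_filter.
apply: (dnorm_sum_orth_proj (f := side_part)) => [|la|la mu U].
- by rewrite filter_uniq // cycle_types_uniq.
- by rewrite mem_filter => /andP[_]; exact: side_part_proj.
by rewrite !mem_filter => /andP[_ laL] /andP[_ muL]; exact: side_part_ortho.
Qed.

End Slices.

(** * Local actions *)

Section LocalAction.
Variables (R : realType) (k : nat) (d : 'I_k -> nat).
Local Notation C := R[i].
Implicit Types (A B : forall j, 'M[C]_(d j)) (t : tensor R d).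

Lemma local_actM A B t :
  local_act B (local_act A t) = local_act (fun j => B j *m A j) t.
Proof.
apply/ffunP => x; rewrite !ffunE.
under [LHS]eq_bigr => y _ do rewrite ffunE mulr_sumr.
rewrite exchange_big; apply: eq_bigr => z _ /=.
under [LHS]eq_bigr => y _ do rewrite mulrA -big_split.
rewrite -mulr_suml -(prod_sum_dffun (fun j l => B j (x j) l * A j l (z j))).
by congr (_ * _); apply: eq_bigr => j _; rewrite mxE.
Qed.

Lemma local_act1 t : local_act (fun=> 1%:M) t = t.
Proof.
apply/ffunP => x; rewrite ffunE -[RHS]dot_basis_vec; apply: eq_bigr => y _.
rewrite ffunE mulrC rmorph_nat eq_sym -(prod_eq_dffun C x y).
by congr (_ * _); apply: eq_bigr => j _; rewrite mxE.
Qed.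

Lemma local_act_neq0 A t :
  (forall j, A j \in unitmx) -> t != 0 -> local_act A t != 0.
Proof.
move=> uA; apply: contraNneq => At0.
have -> : t = local_act (fun j => invmx (A j)) (local_act A t).
  rewrite local_actM -[LHS]local_act1; congr (local_act _ t).
  by apply: functional_extensionality_dep => j; rewrite mulVmx.
by rewrite At0; apply/eqP/ffunP => x; rewrite !ffunE big1 // => y _;
  rewrite ffunE mulr0.
Qed.

Lemma tensor_pow_local_act n A t :
  tensor_pow n (local_act A t) = glact (tensor_mx A) (tensor_pow n t).
Proof.
apply/ffunP => x; rewrite !ffunE; under [LHS]eq_bigr => i _ do rewrite ffunE.
rewrite bigA_distr_bigA; apply: eq_bigr => y _; rewrite ffunE -big_split.
by apply: eq_bigr => i _; rewrite tensor_mxE.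
Qed.

Lemma sact_tensor_pow n t (p : 'S_n) : sact p (tensor_pow n t) = tensor_pow n t.
Proof.
apply/ffunP => x; rewrite !ffunE [RHS](reindex_inj (@perm_inj _ p)).
by apply: eq_bigr => i _; rewrite ffunE.
Qed.

Lemma dot_tensor_pow n t : '[tensor_pow n t] = '[t] ^+ n.
Proof.
rewrite /dot -[in RHS](card_ord n) -prodr_const bigA_distr_bigA.
by apply: eq_bigr => x _; rewrite !ffunE rmorph_prod -big_split.
Qed.

End LocalAction.

(** * Marginals *)

Section Marginals.
Variables (R : realType) (k : nat) (d : 'I_k -> nat) (S : {set 'I_k}).
Variable psi : tensor R d.
Local Notation C := R[i].
Local Notation X := (idxS d S).
Local Notation Y := (idxS d (~: S)).

Definition split_mx : 'M[C]_(#|{: X}|, #|{: Y}|) :=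
  \matrix_(a, c) psi (glue (enum_val a) (enum_val c)).

Lemma split_mxE x y : split_mx (enum_rank x) (enum_rank y) = psi (glue x y).
Proof. by rewrite mxE !enum_rankK. Qed.

Lemma frob_sqr_split_mx : frob_sqr split_mx = '[psi].
Proof.
rewrite /frob_sqr /dot (sum_glue S) /mxtrace sum_enum_rank.
apply: eq_bigr => x _.
by rewrite mxE sum_enum_rank; apply: eq_bigr => y _; rewrite !mxE !enum_rankK.
Qed.

Lemma reduced_density_split_mx : reduced_density split_mx = marginal psi S.
Proof.
apply/matrixP => a b; rewrite /reduced_density frob_sqr_split_mx !mxE.
rewrite sum_enum_rank mulr_sumr; apply: eq_bigr => c _.
by rewrite !mxE !enum_rankK /density mulrC.
Qed.

Lemma slice_tensor_pow n (y : {ffun 'I_n -> Y}) :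
  slice y (tensor_pow n psi) = column_prod split_mx y.
Proof.
apply/ffunP => x; rewrite !ffunE; apply: eq_bigr => i _.
by rewrite ffunE split_mxE.
Qed.

Definition high_entropy (eps : R) n : pred (seq nat) :=
  fun la => vN_entropy (marginal psi S) - eps < shannon_part R n la.

Lemma high_entropy_defect_small (eps eta : R) :
  psi != 0 -> 0 < eps -> 0 < eta ->
  exists N, forall n, (N <= n)%N ->
    '[tensor_pow n psi -
      selected_part S (high_entropy eps n) (tensor_pow n psi)]
    <= '[psi] ^+ n * eta%:C%C.
Proof.
move=> psi0 eps0 eta0.
have frob0 : frob_sqr split_mx != 0 by rewrite frob_sqr_split_mx dnorm_eq0.
have [N smallN] := low_entropy_weight_small frob0 eps0 eta0.
exists N => n /smallN; rewrite reduced_density_split_mx frob_sqr_split_mx.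
apply: le_trans; rewrite dnorm_selected_part_defect le_eqVlt; apply/orP; left.
apply/eqP; apply: eq_big => [la|la _]; first by rewrite leNgt.
rewrite (dot_slice S); apply: eq_bigr => y _.
by rewrite slice_side_part slice_tensor_pow.
Qed.

End Marginals.

(** * Iterated projections *)

Section FoldlLinear.
Variables (K : pzRingType) (W : lmodType K) (J : eqType).
Variable f : J -> {linear W -> W}.
Implicit Types (s : seq J) (v : W).

Lemma foldl_linear_sum (L : Type) (r : seq L) (F : L -> W) s :
  foldl (fun v j => f j v) (\sum_(l <- r) F l) s =
  \sum_(l <- r) foldl (fun v j => f j v) (F l) s.
Proof. by elim: s F => //= j s IHs F; rewrite linear_sum IHs. Qed.

Variables (L : eqType) (l0 : L) (Ls : J -> seq L) (P : J -> L -> W -> W).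
Hypothesis f_sum : forall j v, f j v = \sum_(l <- Ls j) P j l v.

Lemma foldl_choice s v : uniq s -> foldl (fun v j => f j v) v s != 0 ->
  exists la : J -> L, (forall j, j \in s -> la j \in Ls j) /\
    foldl (fun v j => P j (la j) v) v s != 0.
Proof.
elim: s v => [|j s IHs] v /=; first by move=> _ v0; exists (fun=> l0).
move=> /andP[js us]; rewrite f_sum foldl_linear_sum => sum_neq0.
have [l lL Pl_neq0] : exists2 l, l \in Ls j &
    foldl (fun v j => f j v) (P j l v) s != 0.
  apply: contrapT => all0; case/eqP: sum_neq0; apply: big1_seq => l /andP[_ lL].
  by apply/eqP/negPn/negP => neq0; apply: all0; exists l.
have [la [laL la_neq0]] := IHs _ us Pl_neq0.
exists (fun i => if i == j then l else la i); rewrite eqxx; split.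
  by move=> i; rewrite inE; case: eqP => [-> //|_ /=]; exact: laL.
congr (_ != 0): la_neq0.
elim: s js {IHs us sum_neq0 Pl_neq0 laL} (P j l v) => //= i s IHs.
by rewrite inE negb_or eq_sym => /andP[/negPf -> js] w; exact: IHs.
Qed.

End FoldlLinear.

Section Bipartitions.
Variables (R : realType) (k : nat) (d : 'I_k -> nat).
Local Notation C := R[i].
Implicit Types (b : bipartition k) (s : seq (bipartition k)).
Implicit Types (la : bipartition k -> seq nat) (psi : tensor R d).

Definition iter_side_part n la T s : tpow R (idx d) n :=
  foldl (fun T b => side_part (side b) (la b) T) T s.

Lemma bproj_side_part n b mu (T : tpow R (idx d) n) : mu \in cycle_types n ->
  (forall p, sact p T = T) -> bproj b mu T = side_part (side b) mu T.
Proof.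
move=> muL fixT; rewrite /bproj isoprojE // /side_part; congr ext_id.
by rewrite /symmetriser (eq_bigr (fun=> T)) ?sum_const.
Qed.

Lemma foldl_bproj n la s (T : tpow R (idx d) n) :
  (forall b, b \in s -> la b \in cycle_types n) -> (forall p, sact p T = T) ->
  foldl (fun T b => bproj b (la b) T) T s = iter_side_part la T s.
Proof.
elim: s T => //= b s IHs T laL fixT; rewrite bproj_side_part ?laL ?mem_head //.
apply: IHs => [c cs|p]; last by rewrite -side_part_equivariant fixT.
by rewrite laL // inE cs orbT.
Qed.

Lemma iter_side_part_glact_tensor_mx n (A : forall j, 'M[C]_(d j)) la s
    (T : tpow R (idx d) n) :
  iter_side_part la (glact (tensor_mx A) T) s =
  glact (tensor_mx A) (iter_side_part la T s).
Proof.
by elim: s T => //= b s IHs T; rewrite side_part_glact_tensor_mx IHs.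
Qed.

(* For [n] large enough each projection moves the [n]-th power by less than
   [1 / (size s).+1] of its squared norm. *)
Lemma iter_selected_part_neq0 s psi (eps : R) : psi != 0 -> 0 < eps ->
  exists2 n, (0 < n)%N &
    foldl
      (fun T b => selected_part (side b) (high_entropy (side b) psi eps n) T)
      (tensor_pow n psi) s != 0.
Proof.
move=> psi0 eps0; pose eta : R := (size s).+1%:R^-1.
have psi_gt0 : 0 < '[psi] by rewrite dnorm_gt0.
have eta0 : 0 < eta by rewrite invr_gt0 ltr0n.
pose small b := high_entropy_defect_small (side b) psi0 eps0 eta0.
pose N b := projT1 (cid (small b)); pose n := (\max_b N b).+1.
have defect_le b := projT2 (cid (small b)) n (leqW (leq_bigmax b)).
exists n => //; set T := tensor_pow n psi in defect_le *.
pose Q b : {linear tpow R (idx d) n -> tpow R (idx d) n} :=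
  selected_part (side b) (high_entropy (side b) psi eps n).
have Q_proj b (_ : b \in s) : orth_proj (@dot R _) (Q b).
  exact: selected_part_proj.
apply/eqP => QT0; have := gentle_measurement T Q_proj.
rewrite QT0 subr0 /= dot_tensor_pow; apply/negP; rewrite -real_ltNge;
  last 2 first.
- by rewrite ger0_real // sumr_ge0 // => b _; exact: dnorm_ge0.
- by rewrite ger0_real // exprn_ge0 // ltW.
apply: le_lt_trans (ler_sum _ (fun b _ => defect_le b)) _.
rewrite big_const_seq count_predT iter_addr_0 -mulr_natr -mulrA -[ltRHS]mulr1.
rewrite ltr_pM2l ?exprn_gt0 // -(rmorph_nat (real_complex R)) -rmorphM.
rewrite -(rmorph1 (real_complex R)) ltcR mulrC ltr_pdivrMr ?ltr0n // mul1r.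
by rewrite ltr_nat.
Qed.

Lemma high_entropy_types_exist s psi (eps : R) :
  uniq s -> psi != 0 -> 0 < eps ->
  exists n la,
    [/\ (0 < n)%N, forall b, b \in s -> la b \in cycle_types n,
        forall b, b \in s -> high_entropy (side b) psi eps n (la b)
      & iter_side_part la (tensor_pow n psi) s != 0].
Proof.
move=> us psi0 eps0; have [n n0 neq0] := iter_selected_part_neq0 s psi0 eps0.
pose Q b : {linear tpow R (idx d) n -> tpow R (idx d) n} :=
  selected_part (side b) (high_entropy (side b) psi eps n).
have QE b T : Q b T = \sum_(mu <- [seq mu <- cycle_types n |
    high_entropy (side b) psi eps n mu]) side_part (side b) mu T by [].
have [la [laL la_neq0]] := foldl_choice [::] QE us neq0.
by exists n, la; split=> // b /laL; rewrite mem_filter => /andP[].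
Qed.

End Bipartitions.

Lemma prob_avg_le (R : numDomainType) (I : finType) (theta F G : I -> R)
    (s : seq I) (eps : R) :
  (forall i, 0 <= theta i) -> \sum_i theta i = 1 ->
  uniq s -> s =i [pred i | theta i != 0] ->
  (forall i, i \in s -> F i - eps <= G i) ->
  \sum_i theta i * F i - eps <= \sum_(i <- s) theta i * G i.
Proof.
move=> theta0 theta1 us sE FG.
have -> : \sum_i theta i * F i - eps = \sum_i theta i * (F i - eps).
  rewrite -[X in _ - X]mul1r -theta1 mulr_suml -sumrB.
  by apply: eq_bigr => i _; rewrite mulrBr.
rewrite (bigID (mem s)) /= [X in _ + X]big1 => [|i]; last first.
  by rewrite sE inE negbK => /eqP ->; rewrite mul0r.
rewrite addr0 -big_uniq // big_seq [leRHS]big_seq.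
by apply: ler_sum => i si; rewrite ler_wpM2l ?FG.
Qed.

Theorem theorem3p24 (R : realType) (k : nat) (d : 'I_k -> nat)
    (theta : {ffun bipartition k -> R}) (s : seq (bipartition k))
    (t : tensor R d) :
  (3 <= k)%N ->
  is_prob theta ->
  uniq s ->
  s =i [pred b | theta b != 0] ->
  (E_upper theta s t >= E_lower theta t)%E.
Proof.
move=> _ theta_prob us sE; rewrite /E_lower /E_upper; case: eqP => // /eqP t0.
apply: ge_ereal_sup => _ [A [uA ->]]; apply/lee_addgt0Pr => eps eps0.
have [n [la [n0 laL la_high la_neq0]]] :=
  high_entropy_types_exist us (local_act_neq0 uA t0) eps0.
rewrite -leeBlDr //; apply: le_trans (ereal_sup_ubound _); last first.
  exists n, la; split=> [//|b /laL/cycle_types_part //||//].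
  rewrite foldl_bproj //; last exact: sact_tensor_pow.
  apply: contraNneq la_neq0; rewrite tensor_pow_local_act.
  by rewrite iter_side_part_glact_tensor_mx => ->; rewrite linear0.
rewrite -EFinB lee_fin; have [theta0 theta1] := theta_prob.
by apply: prob_avg_le => // b /la_high/ltW.
Qed.
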